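(* For each positive integer $J$ let $\mathcal U(J)$ be the set of $q\in(1,J+1]$ such that $1$ has exactly one expansion $1=\sum_{i\ge1}d_iq^{-i}$ with $d_i\in\{0,1,\dots,J\}$. Let $M$ be a positive integer. (i) For every $K\in\{1,2,\dots,M\}$, \[\dim_H\Big(\bigcap_{J=K}^M\mathcal U(J)\Big)=\max_{1<q\le K+1}\dim_H\mathcal U_q^{(M)} .\] (ii) For every positive integer $L$, \[\dim_H\Big(\mathcal U(L)\setminus\bigcup_{J\ne L}\mathcal U(J)\Big)=1,\] where the union is over all positive integers $J\neq L$.
   Context: For $q\in(1,M+1]$, $\mathcal U^{(M)}_q$ denotes the set of $x\in[0,M/(q-1)]$ that have exactly one expansion $x=\sum_{i\ge1}x_iq^{-i}$ with all $x_i\in\{0,1,\dots,M\}$. *)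

(* Defs.v *)
From Stdlib Require Import Reals.
From Coquelicot Require Import Coquelicot.
Open Scope R_scope.

(* [d] is an expansion of [x] in base [q] with alphabet {0,..,M}:
   x = sum_{i>=1} d_i q^{-i}; here [d n] is the digit d_{n+1}. *)
Definition is_expansion (M : nat) (q x : R) (d : nat -> nat) : Prop :=
  (forall n, (d n <= M)%nat) /\
  is_series (fun n => INR (d n) / q ^ (S n)) x.

Definition unique_expansion (M : nat) (q x : R) : Prop :=
  exists d, is_expansion M q x d /\
    forall d', is_expansion M q x d' -> forall n, d' n = d n.

Definition univoque_set (M : nat) (q : R) : R -> Prop :=
  fun x => 0 <= x <= INR M / (q - 1) /\ unique_expansion M q x.

Definition univoque_bases (J : nat) : R -> Prop :=
  fun q => 1 < q <= INR J + 1 /\ unique_expansion J q 1.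

(* diameter (m_infty for the empty set, p_infty for unbounded sets) *)
Definition diam (U : R -> Prop) : Rbar :=
  Lub_Rbar (fun r => exists x y, U x /\ U y /\ r = Rabs (x - y)).

Definition rpow (d s : R) : R :=
  if Req_EM_T d 0 then (if Req_EM_T s 0 then 1 else 0) else Rpower d s.

(* contribution diam(U)^s of a cover element (0 for the empty set) *)
Definition diam_pow (s : R) (U : R -> Prop) : R :=
  match diam U with Finite d => rpow d s | _ => 0 end.

(* H^s_delta(A) = inf { sum_n diam(U_n)^s : (U_n) countable cover of A,
   diam U_n <= delta }  (p_infty if every such sum diverges) *)
Definition hausdorff_content (s delta : R) (A : R -> Prop) : Rbar :=
  Glb_Rbar (fun v => exists U : nat -> R -> Prop,
    (forall x, A x -> exists n, U n x) /\
    (forall n, Rbar_le (diam (U n)) (Finite delta)) /\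
    is_series (fun n => diam_pow s (U n)) v).

(* H^s(A) = sup_{delta > 0} H^s_delta(A) = 0, i.e. all H^s_delta(A) vanish *)
Definition hausdorff_null (s : R) (A : R -> Prop) : Prop :=
  forall delta, 0 < delta -> hausdorff_content s delta A = Finite 0.

Definition hausdorff_dim (A : R -> Prop) : Rbar :=
  Glb_Rbar (fun s => 0 <= s /\ hausdorff_null s A).

(* Main.v *)
(* Put B = K + 1, t = M - K, and let N = 2K - M + 1 be the number of digits in
   [t, K] (N = 1 if there are none). Both sides of (i) equal D = log N / log B,
   and the maximum is attained at q0 = B.

   Upper bounds. If q <= B, then all tails of a unique expansion in base q
   eventually have value below 1, and so have their reflections; this forces the
   digits into [t, K]. Let Z = 1 - t / (q - 1), the bound on the values of the
   tails once t has been subtracted from every digit. Concavity of x -> x^D and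
   B^D = N show that (z / Z)^D q^(nD), up to a factor n + 1, bounds the number of
   admissible words of length n with value below z, for every q <= B. This gives
   dim U_q <= D. In the parameter space the expansion of 1 in base q is
   admissible for every larger base p, so [p^theta, p] contains at most
   (n + 1) p^(nD) cylinders of length n, each of diameter O(p^(-theta n)); let
   theta tend to 1.

   Lower bounds. Words made of blocks t K w_1 ... w_m with free digits w_i give
   points of U_B, and when preceded by K^(m+2) they are the unique expansions of 1
   in bases q <= B. Two of them that first differ at the j-th free digit lie at
   distance at least c B^(-j (1 + 2/m)), so the dimension is at least
   D / (1 + 2/m).

   For (ii) take K = M = L: then t = 0 and D = 1, the bases constructed exceed L,
   and the word L 0 at the end of the first run gives a second expansion over
   every larger alphabet. *)

Require Import Defs.
From Stdlib Require Import Reals Lra Lia List Arith Cantor Classical ClassicalEpsilon.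
From Coquelicot Require Import Coquelicot.
Open Scope R_scope.

(** * Expansions and their tails *)

Local Ltac pow_nz := repeat split; try apply pow_nonzero; lra.

Definition dval (q : R) (d : nat -> nat) : R :=
  Series (fun n => INR (d n) / q ^ S n).

Definition tail (i : nat) (d : nat -> nat) : nat -> nat := fun n => d (i + n)%nat.

Definition bounded (M : nat) (d : nat -> nat) : Prop := forall n, (d n <= M)%nat.

Lemma bounded_tail M i d : bounded M d -> bounded M (tail i d).
Proof. intros H n; apply H. Qed.

Lemma pow_gt1_pos q n : 1 < q -> 0 < q ^ n.
Proof. intros; apply pow_lt; lra. Qed.

Lemma is_series_const_digits (q c : R) : 1 < q ->
  is_series (fun n => c / q ^ S n) (c / (q - 1)).
Proof.
  intros Hq.
  assert (Hg : is_series (fun n => (/ q) ^ n) (/ (1 - / q))).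
  { apply is_series_geom. rewrite Rabs_pos_eq.
    - rewrite <- Rinv_1. apply Rinv_lt_contravar; lra.
    - left; apply Rinv_0_lt_compat; lra. }
  apply (is_series_scal_l (c / q)) in Hg.
  replace (c / (q - 1)) with (scal (c / q) (/ (1 - / q))).
  2:{ unfold scal; simpl; unfold mult; simpl. field. lra. }
  refine (is_series_ext _ _ _ _ Hg). intros n.
  unfold scal; simpl; unfold mult; simpl.
  rewrite pow_inv. field. pow_nz.
Qed.

Lemma ex_series_digits M q d : 1 < q -> bounded M d ->
  ex_series (fun n => INR (d n) / q ^ S n).
Proof.
  intros Hq Hd.
  apply (ex_series_le (K := R_AbsRing) (V := R_CompleteNormedModule) _ (fun n => INR M / q ^ S n)).
  - intros n. unfold norm; simpl. unfold abs; simpl.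
    assert (0 < q * q ^ n) by (apply (pow_gt1_pos q (S n)); auto).
    rewrite Rabs_pos_eq.
    + apply Rmult_le_compat_r; [left; apply Rinv_0_lt_compat; auto|]. apply le_INR, Hd.
    + apply Rmult_le_pos; [apply pos_INR|left; apply Rinv_0_lt_compat; auto].
  - eexists; apply is_series_const_digits; auto.
Qed.

Lemma is_expansion_dval M q x d : 1 < q ->
  is_expansion M q x d <-> bounded M d /\ dval q d = x.
Proof.
  intros Hq; split; intros [H1 H2]; split; auto.
  - apply is_series_unique; auto.
  - subst. apply Series_correct. eapply ex_series_digits; eauto.
Qed.

Lemma dval_ext q d e : (forall n, d n = e n) -> dval q d = dval q e.
Proof. intros H. apply Series_ext. intros n. now rewrite H. Qed.

Lemma dval_cons M q d : 1 < q -> bounded M d ->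
  dval q d = (INR (d 0%nat) + dval q (tail 1 d)) / q.
Proof.
  intros Hq Hd. unfold dval at 1.
  rewrite Series_incr_1 by (eapply ex_series_digits; eauto).
  unfold Rdiv at 3. rewrite Rmult_plus_distr_r. f_equal.
  - simpl. field. lra.
  - unfold dval. rewrite Rmult_comm, <- Series_scal_l. apply Series_ext. intros n.
    unfold tail. simpl. field. pow_nz.
Qed.

Lemma dval_tail M q d i : 1 < q -> bounded M d ->
  q * dval q (tail i d) = INR (d i) + dval q (tail (S i) d).
Proof.
  intros Hq Hd.
  rewrite (dval_cons M) by (auto using bounded_tail).
  replace (dval q (tail 1 (tail i d))) with (dval q (tail (S i) d)).
  - unfold tail at 1. rewrite Nat.add_0_r. field. lra.
  - apply dval_ext. intros n. unfold tail. f_equal. lia.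
Qed.

Lemma dval_le M q d e : 1 < q -> bounded M e -> (forall n, (d n <= e n)%nat) ->
  dval q d <= dval q e.
Proof.
  intros Hq He H. apply Series_le.
  - intros n. assert (0 < / q ^ S n) by (apply Rinv_0_lt_compat, pow_gt1_pos; auto).
    split; [apply Rmult_le_pos; [apply pos_INR|lra]|].
    apply Rmult_le_compat_r; [lra|]. apply le_INR, H.
  - eapply ex_series_digits; eauto.
Qed.

Lemma dval_const q k : 1 < q -> dval q (fun _ => k) = INR k / (q - 1).
Proof. intros. apply is_series_unique, is_series_const_digits; auto. Qed.

Lemma dval_le_max M q d : 1 < q -> bounded M d -> dval q d <= INR M / (q - 1).
Proof.
  intros Hq Hd. rewrite <- dval_const by auto. apply (dval_le M); auto. intros ?; auto.
Qed.

Lemma dval_ge0 M q d : 1 < q -> bounded M d -> 0 <= dval q d.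
Proof.
  intros Hq Hd. replace 0 with (dval q (fun _ => 0%nat)).
  - apply (dval_le M); auto. intros; lia.
  - rewrite dval_const by auto. simpl. field. lra.
Qed.

Definition reflect (M : nat) (d : nat -> nat) : nat -> nat := fun n => (M - d n)%nat.

Lemma bounded_reflect M d : bounded M (reflect M d).
Proof. intros n; unfold reflect; lia. Qed.

Lemma dval_reflect M q d : 1 < q -> bounded M d ->
  dval q (reflect M d) = INR M / (q - 1) - dval q d.
Proof.
  intros Hq Hd. rewrite <- dval_const by auto. unfold dval.
  rewrite <- Series_minus.
  - apply Series_ext. intros n. unfold reflect. rewrite minus_INR by apply Hd.
    unfold Rdiv. ring.
  - apply (ex_series_digits M); auto. intros ?; auto.
  - apply (ex_series_digits M); auto.
Qed.

Lemma dval_ge_term M q d j : 1 < q -> bounded M d -> INR (d j) / q ^ S j <= dval q d.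
Proof.
  intros Hq. revert d. induction j as [|j IH]; intros d Hd; rewrite (dval_cons M q d) by auto.
  - rewrite pow_1. apply Rmult_le_compat_r; [left; apply Rinv_0_lt_compat; lra|].
    pose proof (dval_ge0 M q (tail 1 d) Hq (bounded_tail _ _ _ Hd)). lra.
  - specialize (IH (tail 1 d) (bounded_tail _ _ _ Hd)). unfold tail in IH at 1.
    replace (INR (d (S j)) / q ^ S (S j)) with ((INR (d (1 + j)%nat) / q ^ S j) / q).
    2:{ simpl. field. pow_nz. }
    apply Rmult_le_compat_r; [left; apply Rinv_0_lt_compat; lra|].
    pose proof (pos_INR (d 0%nat)). lra.
Qed.

Lemma dval_agree M q d e n : 1 < q -> bounded M d -> bounded M e ->
  (forall i, (i < n)%nat -> d i = e i) ->
  dval q d - dval q e = (dval q (tail n d) - dval q (tail n e)) / q ^ n.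
Proof.
  intros Hq Hd He. induction n as [|n IH]; intros H.
  - rewrite pow_O. unfold Rdiv. rewrite Rinv_1, Rmult_1_r. reflexivity.
  - rewrite IH by (intros; apply H; lia).
    pose proof (dval_tail M q d n Hq Hd) as E1. pose proof (dval_tail M q e n Hq He) as E2.
    rewrite (H n) in E1 by lia.
    replace (dval q (tail (S n) d) - dval q (tail (S n) e))
      with (q * (dval q (tail n d) - dval q (tail n e))) by lra.
    simpl. field. pow_nz.
Qed.

Lemma dval_decreasing M q q' d : 1 < q <= q' -> bounded M d -> dval q' d <= dval q d.
Proof.
  intros Hq Hd. apply Series_le.
  - intros n. assert (0 < / q' ^ S n) by (apply Rinv_0_lt_compat, pow_gt1_pos; lra).
    split; [apply Rmult_le_pos; [apply pos_INR|lra]|].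
    apply Rmult_le_compat_l; [apply pos_INR|].
    apply Rinv_le_contravar; [apply pow_gt1_pos; lra|]. apply pow_incr; lra.
  - apply (ex_series_digits M); auto; lra.
Qed.

(** Peeling off one digit multiplies the error by at most [1 / q <= 2 / 3] and adds at most
    [3 M |q - q'|]; the constant 9 is the fixed point of [c = 2 c / 3 + 3]. Keeping the bases at or
    above 3/2 makes this contraction, and the bound [2 M] on all values, uniform. *)
Lemma dval_lipschitz M q q' d : 3 / 2 <= q -> 3 / 2 <= q' -> bounded M d ->
  Rabs (dval q d - dval q' d) <= 9 * INR M * Rabs (q - q').
Proof.
  intros Hq Hq' Hd0.
  pose proof (pos_INR M) as HM. pose proof (Rabs_pos (q - q')) as HA.
  assert (Hup : forall p d, 3 / 2 <= p -> bounded M d -> 0 <= dval p d <= 2 * INR M).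
  { intros p d' Hp Hd'. split; [apply (dval_ge0 M); (auto; lra)|].
    eapply Rle_trans; [apply (dval_le_max M); auto; lra|].
    unfold Rdiv. rewrite Rmult_comm. apply Rmult_le_compat_r; auto.
    replace 2 with (/ (1 / 2)) by field. apply Rinv_le_contravar; lra. }
  (* After [n] peeled digits the untreated tails contribute at most [2 M / q ^ n], which disappears
     as [n] grows. *)
  assert (H : forall n d, bounded M d ->
    Rabs (dval q d - dval q' d) <= 9 * INR M * Rabs (q - q') + 2 * INR M / q ^ n).
  { induction n as [|n IH]; intros d' Hd'.
    - pose proof (Hup q d' Hq Hd'). pose proof (Hup q' d' Hq' Hd').
      assert (0 <= INR M * Rabs (q - q')) by (apply Rmult_le_pos; auto).
      rewrite pow_O. apply Rabs_le. lra.
    - specialize (IH (tail 1 d') (bounded_tail _ _ _ Hd')).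
      rewrite (dval_cons M q d'), (dval_cons M q' d') by (auto; lra).
      set (T := dval q (tail 1 d')) in *. set (T' := dval q' (tail 1 d')) in *.
      assert (HT' : 0 <= T' <= 2 * INR M) by (apply Hup; auto using bounded_tail).
      assert (Hd0' : 0 <= INR (d' 0%nat) <= INR M) by (split; [apply pos_INR|apply le_INR, Hd']).
      replace ((INR (d' 0%nat) + T) / q - (INR (d' 0%nat) + T') / q')
        with ((T - T') / q + (INR (d' 0%nat) + T') / (q * q') * (q' - q)) by (field; lra).
      eapply Rle_trans; [apply Rabs_triang|].
      assert (Hiq : 0 < / q <= 2 / 3).
      { split; [apply Rinv_0_lt_compat; lra|]. replace (2/3) with (/ (3/2)) by field.
        apply Rinv_le_contravar; lra. }
      assert (Hiqq : 0 <= (INR (d' 0%nat) + T') / (q * q') <= 3 * INR M).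
      { assert (1 <= q * q') by nra.
        assert (0 < / (q * q') <= 1).
        { split; [apply Rinv_0_lt_compat; lra|]. rewrite <- Rinv_1. apply Rinv_le_contravar; lra. }
        unfold Rdiv. split; nra. }
      unfold Rdiv at 1. rewrite (Rabs_mult (T - T')), (Rabs_mult (_ / (q * q'))), (Rabs_minus_sym q' q).
      rewrite (Rabs_pos_eq (_ / (q * q'))), (Rabs_pos_eq (/ q)) by lra.
      replace (2 * INR M / q ^ S n) with (2 * INR M / q ^ n * / q)
        by (simpl; field; pow_nz).
      set (X := Rabs (q - q')) in *. set (Y := 2 * INR M / q ^ n) in *.
      assert (Rabs (T - T') * / q <= (9 * INR M * X + Y) * / q)
        by (apply Rmult_le_compat_r; lra).
      assert ((INR (d' 0%nat) + T') / (q * q') * X <= 3 * INR M * X)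
        by (apply Rmult_le_compat_r; lra).
      assert (0 <= INR M * X) by (apply Rmult_le_pos; auto).
      assert (INR M * X * / q <= INR M * X * (2/3)) by (apply Rmult_le_compat_l; lra).
      nra. }
  apply Rle_plus_epsilon. intros eps Heps.
  assert (Hlim : exists n, 2 * INR M / q ^ n < eps).
  { destruct (pow_lt_1_zero (/ q)) with (y := eps / (2 * INR M + 1)) as [n Hn].
    - rewrite Rabs_pos_eq; [rewrite <- Rinv_1; apply Rinv_lt_contravar; lra|].
      left; apply Rinv_0_lt_compat; lra.
    - apply Rdiv_lt_0_compat; lra.
    - exists n. specialize (Hn n (Nat.le_refl _)).
      rewrite pow_inv in Hn.
      assert (Hp : 0 < / q ^ n) by (apply Rinv_0_lt_compat, pow_gt1_pos; lra).
      rewrite Rabs_pos_eq in Hn by lra.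
      apply Rmult_lt_compat_r with (r := 2 * INR M + 1) in Hn; [|lra].
      unfold Rdiv in Hn. rewrite Rmult_assoc, Rinv_l, Rmult_1_r in Hn by lra.
      unfold Rdiv. nra. }
  destruct Hlim as [n Hn]. specialize (H n d Hd0). lra.
Qed.

(* The largest [k <= n] with [k <= y] (and [0] if there is none). *)
Fixpoint kmax (n : nat) (y : R) : nat :=
  match n with
  | O => O
  | S n' => if Rle_dec (INR n) y then n else kmax n' y
  end.

Lemma kmax_le n y : (kmax n y <= n)%nat.
Proof. induction n; cbn [kmax]; [lia|]. destruct Rle_dec; lia. Qed.

Lemma kmax_spec n y : 0 <= y -> INR (kmax n y) <= y.
Proof. intros; induction n; cbn [kmax]; [simpl; lra|]. destruct Rle_dec; auto. Qed.

Lemma kmax_max n y : (kmax n y < n)%nat -> y < INR (kmax n y) + 1.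
Proof.
  induction n; intros H; [lia|]. cbn [kmax] in *. destruct Rle_dec; [lia|].
  destruct (Nat.eq_dec (kmax n y) n) as [E|E].
  - rewrite E. rewrite S_INR in n0. lra.
  - apply IHn. pose proof (kmax_le n y). lia.
Qed.

Section Greedy.
Variables (M : nat) (q : R).

(** The remainder of [x] after [n] greedy digits, rescaled by [q ^ n]; the next digit is
    [kmax M (q * greedy_rest x n)]. *)
Fixpoint greedy_rest (x : R) (n : nat) : R :=
  match n with
  | O => x
  | S n => q * greedy_rest x n - INR (kmax M (q * greedy_rest x n))
  end.

Lemma greedy_rest_bounds x n : 1 < q <= INR M + 1 -> 0 <= x <= INR M / (q - 1) ->
  0 <= greedy_rest x n <= INR M / (q - 1).
Proof.
  intros Hq Hx. induction n as [|n IH]; [auto|]. simpl.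
  set (r := greedy_rest x n) in *. set (k := kmax M (q * r)).
  assert (Hk : INR k <= q * r) by (apply kmax_spec; nra).
  assert (H1 : 1 <= INR M / (q - 1)).
  { apply Rmult_le_reg_r with (q - 1); [lra|]. unfold Rdiv.
    rewrite Rmult_assoc, Rinv_l; lra. }
  split; [lra|].
  destruct (Nat.lt_ge_cases k M) as [L|L].
  - pose proof (kmax_max M (q * r) L). fold k in H. lra.
  - assert (k = M) by (pose proof (kmax_le M (q * r)); fold k in H; lia). rewrite H.
    assert (E : q * (INR M / (q - 1)) = INR M + INR M / (q - 1)) by (field; lra).
    nra.
Qed.
End Greedy.

(** The tails of the greedy sequence and the greedy remainders obey the same recursion and stay in
    the same bounded interval, so the error is at most [C / q ^ n] for every [n] and hence zero. *)
Lemma expansion_exists M q x : 1 < q <= INR M + 1 -> 0 <= x <= INR M / (q - 1) ->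
  exists d, is_expansion M q x d.
Proof.
  intros Hq Hx. exists (fun n => kmax M (q * greedy_rest M q x n)).
  set (d := fun n => kmax M (q * greedy_rest M q x n)).
  assert (Hd : bounded M d) by (intros n; apply kmax_le).
  apply is_expansion_dval; [lra|]. split; auto.
  set (r := greedy_rest M q x).
  assert (E : forall n, dval q d - x = (dval q (tail n d) - r n) / q ^ n).
  { induction n as [|n IH].
    - rewrite pow_O. unfold Rdiv. rewrite Rinv_1, Rmult_1_r. reflexivity.
    - rewrite IH. pose proof (dval_tail M q d n (proj1 Hq) Hd).
      assert (r (S n) = q * r n - INR (d n)) by reflexivity.
      replace (dval q (tail (S n) d) - r (S n)) with (q * (dval q (tail n d) - r n)) by lra.
      simpl. field. pow_nz. }
  set (C := INR M / (q - 1)).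
  assert (B : forall n, Rabs (dval q d - x) <= C / q ^ n).
  { intros n. rewrite (E n). unfold Rdiv. rewrite Rabs_mult.
    assert (0 < / q ^ n) by (apply Rinv_0_lt_compat, pow_gt1_pos; lra).
    rewrite (Rabs_pos_eq (/ q ^ n)) by lra. apply Rmult_le_compat_r; [lra|].
    pose proof (greedy_rest_bounds M q x n Hq Hx).
    pose proof (dval_ge0 M q (tail n d) (proj1 Hq) (bounded_tail _ _ _ Hd)).
    pose proof (dval_le_max M q (tail n d) (proj1 Hq) (bounded_tail _ _ _ Hd)).
    apply Rabs_le. unfold r, C. lra. }
  apply Rminus_diag_uniq. apply NNPP; intros NE.
  pose proof (Rabs_pos_lt _ NE) as Hp.
  destruct (Pow_x_infinity q) with (b := C / Rabs (dval q d - x) + 1) as [n Hn].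
  { rewrite Rabs_pos_eq; lra. }
  specialize (Hn n (Nat.le_refl _)). specialize (B n).
  pose proof (pow_gt1_pos q n (proj1 Hq)).
  rewrite Rabs_pos_eq in Hn by lra.
  apply Rmult_le_compat_r with (r := q ^ n) in B; [|lra].
  unfold Rdiv in B at 1. rewrite Rmult_assoc, Rinv_l, Rmult_1_r in B by lra.
  assert (Rabs (dval q d - x) * (C / Rabs (dval q d - x) + 1) <= Rabs (dval q d - x) * q ^ n)
    by (apply Rmult_le_compat_l; lra).
  assert (Rabs (dval q d - x) * (C / Rabs (dval q d - x) + 1) = C + Rabs (dval q d - x))
    by (field; lra).
  lra.
Qed.

(** * Uniqueness as a condition on tails *)

Lemma first_difference (d e : nat -> nat) : (exists n, d n <> e n) ->
  exists n, d n <> e n /\ forall i, (i < n)%nat -> d i = e i.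
Proof.
  intros [n Hn].
  assert (H : forall k, (exists n, (n < k)%nat /\ d n <> e n) ->
    exists n, d n <> e n /\ forall i, (i < n)%nat -> d i = e i).
  { induction k as [|k IH]; intros [j [Hj Hd]]; [lia|].
    destruct (classic (exists n, (n < k)%nat /\ d n <> e n)) as [H|H]; auto.
    exists j. split; auto. intros i Hi. apply NNPP; intros Hne. apply H. exists i.
    split; [lia|auto]. }
  apply (H (S n)). exists n; auto.
Qed.

(** Up to the first index where a competitor differs, both sequences leave tails of equal value. A
    larger competing digit would force the tail of [d] after it to have value at least 1; a smaller
    one would force the same for the reflected tail. *)
Lemma unique_of_tails M q d : 1 < q -> bounded M d ->
  (forall i, (d i < M)%nat -> dval q (tail (S i) d) < 1) ->
  (forall i, (0 < d i)%nat -> dval q (reflect M (tail (S i) d)) < 1) ->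
  unique_expansion M q (dval q d).
Proof.
  intros Hq Hd Hu Hl. exists d. split; [apply is_expansion_dval; auto|].
  intros e He n. apply NNPP; intros Hne.
  destruct (first_difference d e) as [i [Hi Hlt]]; [exists n; auto|].
  apply is_expansion_dval in He as [Hb He]; auto.
  pose proof (dval_agree M q d e i Hq Hd Hb Hlt) as E.
  rewrite He, Rminus_diag in E.
  assert (E2 : dval q (tail i d) - dval q (tail i e) = 0).
  { pose proof (pow_gt1_pos q i Hq).
    apply (f_equal (fun z => z * q ^ i)) in E. unfold Rdiv in E.
    rewrite Rmult_assoc, Rinv_l, Rmult_0_l, Rmult_1_r in E by lra. lra. }
  pose proof (dval_tail M q d i Hq Hd). pose proof (dval_tail M q e i Hq Hb).
  pose proof (dval_ge0 M q _ Hq (bounded_tail _ (S i) _ Hb)).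
  pose proof (dval_le_max M q _ Hq (bounded_tail _ (S i) _ Hb)).
  assert (q * dval q (tail i d) = q * dval q (tail i e)) by (f_equal; lra).
  destruct (Nat.lt_gt_cases (d i) (e i)) as [[L|L] _]; auto.
  - assert (d i < M)%nat by (specialize (Hb i); lia). specialize (Hu i H4).
    apply le_INR in L. rewrite S_INR in L. lra.
  - assert (0 < d i)%nat by lia. specialize (Hl i H4).
    rewrite dval_reflect in Hl by auto using bounded_tail.
    apply le_INR in L. rewrite S_INR in L. lra.
Qed.

Definition splice (i k : nat) (d e : nat -> nat) : nat -> nat :=
  fun n => if (n <? i)%nat then d n else if (n =? i)%nat then k else e (n - S i)%nat.

Lemma dval_splice M q i k d e : 1 < q -> bounded M d -> bounded M e -> (k <= M)%nat ->
  INR k + dval q e = INR (d i) + dval q (tail (S i) d) ->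
  bounded M (splice i k d e) /\ dval q (splice i k d e) = dval q d.
Proof.
  intros Hq Hd He Hk E.
  assert (Hb : bounded M (splice i k d e)).
  { intros n. unfold splice. destruct (n <? i)%nat; auto. destruct (n =? i)%nat; auto. }
  split; auto.
  assert (E1 : dval q (splice i k d e) - dval q d
    = (dval q (tail i (splice i k d e)) - dval q (tail i d)) / q ^ i).
  { apply (dval_agree M); auto. intros j Hj. unfold splice.
    apply Nat.ltb_lt in Hj. now rewrite Hj. }
  pose proof (dval_tail M q _ i Hq Hb) as E2. pose proof (dval_tail M q d i Hq Hd) as E3.
  replace (dval q (tail (S i) (splice i k d e))) with (dval q e) in E2.
  2:{ apply dval_ext. intros n. unfold tail, splice.
      replace (S i + n <? i)%nat with false by (symmetry; apply Nat.ltb_ge; lia).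
      replace (S i + n =? i)%nat with false by (symmetry; apply Nat.eqb_neq; lia).
      f_equal. lia. }
  unfold splice in E2 at 2. rewrite Nat.ltb_irrefl, Nat.eqb_refl in E2.
  assert (dval q (tail i (splice i k d e)) = dval q (tail i d)).
  { apply Rmult_eq_reg_l with q; lra. }
  rewrite H, Rminus_diag in E1. unfold Rdiv in E1. lra.
Qed.

(** Converse of [unique_of_tails]. If a tail has value at least 1 after a digit below [M], raise
    that digit by one: the tail value minus 1 still lies in [[0, M / (q - 1)]], so it has an
    expansion, and splicing it in gives a second expansion of [x]. Reflected tails are treated by
    lowering the digit. *)
Lemma tails_of_unique M q x d : 1 < q <= INR M + 1 ->
  is_expansion M q x d -> (forall e, is_expansion M q x e -> forall n, e n = d n) ->
  (forall i, (d i < M)%nat -> dval q (tail (S i) d) < 1) /\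
  (forall i, (0 < d i)%nat -> dval q (reflect M (tail (S i) d)) < 1).
Proof.
  intros Hq Hx Hun. apply is_expansion_dval in Hx as [Hd Hx]; [|lra].
  (* Any expansion of the value left over once digit [i] is replaced by [k] splices into an
     expansion of [x], so uniqueness forces [k] to be the old digit. *)
  assert (Hmod : forall i k e, (k <= M)%nat -> is_expansion M q (INR (d i) + dval q (tail (S i) d) - INR k) e ->
     d i = k).
  { intros i k e Hk He. apply is_expansion_dval in He as [Hb He]; [|lra].
    destruct (dval_splice M q i k d e) as [H1 H2]; auto; try lra.
    assert (H := Hun (splice i k d e)). rewrite <- (H) with (n := i).
    - unfold splice. now rewrite Nat.ltb_irrefl, Nat.eqb_refl.
    - apply is_expansion_dval; [lra|]. split; auto; lra. }
  split; intros i Hi; apply Rnot_le_lt; intros Hge;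
    pose proof (dval_ge0 M q _ (proj1 Hq) (bounded_tail _ (S i) _ Hd));
    pose proof (dval_le_max M q _ (proj1 Hq) (bounded_tail _ (S i) _ Hd)).
  - destruct (expansion_exists M q (INR (d i) + dval q (tail (S i) d) - INR (S (d i)))) as [e He]; auto.
    + rewrite S_INR. lra.
    + apply Hmod in He; lia.
  - rewrite dval_reflect in Hge by (auto using bounded_tail; lra).
    destruct (expansion_exists M q (INR (d i) + dval q (tail (S i) d) - INR (d i - 1))) as [e He]; auto.
    + rewrite minus_INR by lia. simpl. lra.
    + specialize (Hd i). apply Hmod in He; lia.
Qed.

(** * Null sets for Hausdorff measures *)

Fixpoint psum (f : nat -> R) (n : nat) : R :=
  match n with O => 0 | S n => psum f n + f n end.

Lemma psum_ext f g n : (forall i, (i < n)%nat -> f i = g i) -> psum f n = psum g n.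
Proof. induction n; intros H; simpl; auto. rewrite IHn, H by (intros; try apply H; lia). auto. Qed.

Lemma psum_le f g n : (forall i, (i < n)%nat -> f i <= g i) -> psum f n <= psum g n.
Proof.
  induction n; intros H; simpl; [lra|].
  assert (f n <= g n) by (apply H; lia). assert (psum f n <= psum g n) by (apply IHn; intros; apply H; lia).
  lra.
Qed.

Lemma psum_const c n : psum (fun _ => c) n = INR n * c.
Proof. induction n; [simpl; lra|]. cbn [psum]. rewrite IHn, S_INR. lra. Qed.

Lemma psum_plus f g n : psum (fun i => f i + g i) n = psum f n + psum g n.
Proof. induction n; simpl; lra. Qed.

Lemma psum_scal c f n : psum (fun i => c * f i) n = c * psum f n.
Proof. induction n; simpl; lra. Qed.

Lemma psum_ge0 f n : (forall i, 0 <= f i) -> 0 <= psum f n.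
Proof. intros H; induction n; simpl; [lra|]. specialize (H n). lra. Qed.

Lemma psum_incr f m n : (forall i, 0 <= f i) -> (m <= n)%nat -> psum f m <= psum f n.
Proof. intros H L; induction L; simpl; [lra|]. specialize (H m0). lra. Qed.

Lemma psum_term f i n : (forall i, 0 <= f i) -> (i < n)%nat -> f i <= psum f n.
Proof.
  intros H L. apply Rle_trans with (psum f (S i)); [|apply psum_incr; auto].
  simpl. pose proof (psum_ge0 f i H). lra.
Qed.

Lemma psum_exchange f m n :
  psum (fun i => psum (fun j => f i j) n) m = psum (fun j => psum (fun i => f i j) m) n.
Proof.
  induction m; simpl.
  - rewrite psum_const. lra.
  - rewrite IHm, <- psum_plus. auto.
Qed.

Lemma psum_halves e n : 0 <= e -> psum (fun k => e / 2 ^ S k) n <= e.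
Proof.
  intros He. assert (H : psum (fun k => e / 2 ^ S k) n = e - e / 2 ^ n).
  { induction n; [simpl; lra|]. cbn [psum]. rewrite IHn. simpl. field. apply pow_nonzero; lra. }
  rewrite H. assert (0 < / 2 ^ n) by (apply Rinv_0_lt_compat, pow_lt; lra).
  unfold Rdiv. nra.
Qed.

Lemma sum_n_psum (f : nat -> R) n : sum_n f n = psum f (S n).
Proof.
  induction n; [rewrite sum_O; simpl; lra|]. rewrite sum_Sn, IHn. reflexivity.
Qed.

Lemma series_of_bounded (f : nat -> R) E : (forall n, 0 <= f n) -> (forall n, psum f n <= E) ->
  exists v, is_series f v /\ 0 <= v <= E.
Proof.
  intros H0 HE.
  destruct (ex_finite_lim_seq_incr (sum_n f) E) as [v Hv].
  - intros n. rewrite !sum_n_psum. apply psum_incr; auto.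
  - intros n. rewrite sum_n_psum. auto.
  - exists v. split; [exact Hv|]. split.
    + apply (is_lim_seq_le (fun _ => 0) (sum_n f) 0 v); auto using is_lim_seq_const.
      intros n. rewrite sum_n_psum. apply psum_ge0; auto.
    + apply (is_lim_seq_le (sum_n f) (fun _ => E) v E); auto using is_lim_seq_const.
      intros n. rewrite sum_n_psum. auto.
Qed.

Lemma psum_le_series (f : nat -> R) v n : (forall n, 0 <= f n) -> is_series f v -> psum f n <= v.
Proof.
  intros H0 Hv.
  apply (is_lim_seq_le_loc (fun _ => psum f n) (sum_n f) (psum f n) v);
    auto using is_lim_seq_const.
  exists n. intros k Hk. rewrite sum_n_psum. apply psum_incr; auto.
Qed.

Lemma rpow_ge0 d s : 0 <= rpow d s.
Proof.
  unfold rpow. repeat destruct Req_EM_T; try lra. left; apply exp_pos.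
Qed.

Lemma rpow_le d c s : 0 < s -> 0 <= d <= c -> rpow d s <= rpow c s.
Proof.
  intros Hs Hd. unfold rpow. destruct (Req_EM_T s 0); [lra|].
  destruct (Req_EM_T d 0), (Req_EM_T c 0); try lra; [left; apply exp_pos|].
  apply Rle_Rpower_l; lra.
Qed.

Lemma diam_le U c : (forall x y, U x -> U y -> Rabs (x - y) <= c) -> Rbar_le (diam U) c.
Proof.
  intros H. unfold diam. apply (Lub_Rbar_correct (fun r => exists x y, U x /\ U y /\ r = Rabs (x - y))).
  intros r (x & y & Hx & Hy & ->). simpl. auto.
Qed.

Lemma diam_ge (U : R -> Prop) x y : U x -> U y -> Rbar_le (Rabs (x - y)) (diam U).
Proof.
  intros Hx Hy. unfold diam. apply (Lub_Rbar_correct (fun r => exists x y, U x /\ U y /\ r = Rabs (x - y))).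
  exists x, y. auto.
Qed.

Lemma diam_pow_ge0 s U : 0 <= diam_pow s U.
Proof. unfold diam_pow. destruct (diam U); try lra. apply rpow_ge0. Qed.

Lemma diam_pow_le s U c : 0 < s -> 0 <= c -> (forall x y, U x -> U y -> Rabs (x - y) <= c) ->
  diam_pow s U <= rpow c s.
Proof.
  intros Hs Hc H. unfold diam_pow. pose proof (diam_le U c H) as Hd.
  destruct (diam U) as [d| |] eqn:E; try apply rpow_ge0.
  simpl in Hd. apply rpow_le; auto. split; auto.
  destruct (classic (exists x, U x)) as [[x Hx]|N].
  - pose proof (diam_ge U x x Hx Hx) as G. rewrite E in G. simpl in G.
    pose proof (Rabs_pos (x - x)). lra.
  - exfalso. unfold diam in E.
    pose proof (proj2 (Lub_Rbar_correct (fun r => exists x y, U x /\ U y /\ r = Rabs (x - y))) m_infty) as G.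
    rewrite E in G. apply G. intros r (x & y & Hx & _). elim N; eauto.
Qed.

(** Explicit size bounds [c n] and bounded partial sums stand in for extended-real diameters and
    convergent series, so that covers can be merged by elementary estimates. *)
Definition small_cover (s delta eps : R) (A : R -> Prop) : Prop :=
  exists (U : nat -> R -> Prop) (c : nat -> R),
    (forall x, A x -> exists n, U n x) /\
    (forall n x y, U n x -> U n y -> Rabs (x - y) <= c n) /\
    (forall n, 0 <= c n <= delta) /\
    (forall n, psum (fun k => rpow (c k) s) n <= eps).

Definition small_covers (s : R) (A : R -> Prop) : Prop :=
  forall delta eps, 0 < delta -> 0 < eps -> small_cover s delta eps A.

Lemma small_covers_null s A : 0 < s -> small_covers s A -> hausdorff_null s A.
Proof.
  intros Hs H delta Hd. unfold hausdorff_content. apply is_glb_Rbar_unique. split.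
  - intros v (U & _ & _ & Hv). simpl.
    apply (is_lim_seq_le (fun _ => 0) (sum_n (fun n => diam_pow s (U n))) 0 v); auto using is_lim_seq_const.
    intros n. rewrite sum_n_psum. apply psum_ge0. intros; apply diam_pow_ge0.
  - intros b Hb.
    assert (G : forall eps, 0 < eps -> Rbar_le b eps).
    { intros eps He. destruct (H delta eps Hd He) as (U & c & H1 & H2 & H3 & H4).
      destruct (series_of_bounded (fun n => diam_pow s (U n)) eps) as (v & Hv & Hv').
      - intros; apply diam_pow_ge0.
      - intros n. eapply Rle_trans; [|apply (H4 n)]. apply psum_le. intros i _.
        apply diam_pow_le; auto. apply H3.
      - apply Rbar_le_trans with v; [|simpl; lra]. apply Hb. exists U. repeat split; auto.
        intros n. apply Rbar_le_trans with (c n); [apply diam_le; auto|]. simpl. apply H3. }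
    destruct b as [b| |]; simpl; auto.
    + apply Rnot_lt_le; intros L. specialize (G (b / 2)). simpl in G. lra.
    + apply (G 1); lra.
Qed.

Lemma small_covers_subset s (A A' : R -> Prop) : (forall x, A' x -> A x) ->
  small_covers s A -> small_covers s A'.
Proof.
  intros Hs H d e Hd He. destruct (H d e Hd He) as (U & c & H1 & H2). exists U, c. auto.
Qed.

Definition lsum {T : Type} (f : T -> R) (l : list T) : R := fold_right (fun x r => f x + r) 0 l.

Lemma lsum_app {T} (f : T -> R) l l' : lsum f (l ++ l') = lsum f l + lsum f l'.
Proof. induction l; simpl; lra. Qed.

Lemma lsum_incl {T} (f : T -> R) l : (forall x, 0 <= f x) -> NoDup l ->
  forall l', incl l l' -> lsum f l <= lsum f l'.
Proof.
  intros Hf. induction 1 as [|x l Hx Hl IH]; intros l' Hi.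
  - simpl. clear Hi. induction l'; simpl; [lra|]. specialize (Hf a). lra.
  - destruct (in_split x l') as (l1 & l2 & ->); [apply Hi; left; auto|].
    simpl. rewrite lsum_app. simpl.
    assert (lsum f l <= lsum f (l1 ++ l2)).
    { apply IH. intros y Hy. assert (In y (l1 ++ x :: l2)) by (apply Hi; right; auto).
      apply in_app_iff in H. apply in_app_iff. destruct H as [H|[H|H]]; auto. subst; tauto. }
    rewrite lsum_app in H. lra.
Qed.

Lemma lsum_ext {T} (f g : T -> R) l : (forall x, f x = g x) -> lsum f l = lsum g l.
Proof. intros H; induction l; simpl; auto. now rewrite H, IHl. Qed.

Lemma psum_lsum {T} (f : T -> R) g n : psum (fun i => f (g i)) n = lsum f (map g (seq 0 n)).
Proof.
  induction n; auto. cbn [psum]. rewrite IHn, seq_S, map_app, lsum_app. simpl. lra.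
Qed.

Lemma lsum_list_prod (f : nat -> nat -> R) l l' :
  lsum (fun p => f (fst p) (snd p)) (list_prod l l') = lsum (fun i => lsum (f i) l') l.
Proof.
  induction l; simpl; auto. rewrite lsum_app, IHl. f_equal.
  clear. induction l'; simpl; auto. rewrite IHl'. auto.
Qed.

(** A pair with Cantor code below [n] has both coordinates below [n], and distinct codes give
    distinct pairs; so the left side sums nonnegative terms over a subset of the square. *)
Lemma psum_cantor (f : nat -> nat -> R) n : (forall i j, 0 <= f i j) ->
  psum (fun k => f (fst (of_nat k)) (snd (of_nat k))) n <= psum (fun i => psum (f i) n) n.
Proof.
  intros Hf.
  rewrite (psum_lsum (fun p => f (fst p) (snd p)) of_nat).
  rewrite (psum_lsum (fun i => psum (f i) n) (fun i => i)), map_id.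
  rewrite (lsum_ext (fun i => psum (f i) n) (fun i => lsum (f i) (seq 0 n))).
  2:{ intros i. rewrite (psum_lsum (f i) (fun j => j)), map_id. auto. }
  rewrite <- lsum_list_prod. apply lsum_incl; auto.
  - apply NoDup_map_inv with (f := to_nat). rewrite map_map.
    rewrite (map_ext _ (fun x => x)) by (intros; apply cancel_to_of).
    rewrite map_id. apply seq_NoDup.
  - intros [i j] H. apply in_map_iff in H as (k & Hk & Hin). apply in_seq in Hin.
    pose proof (to_nat_non_decreasing i j) as G. rewrite <- Hk, cancel_to_of in G.
    apply in_prod; apply in_seq; lia.
Qed.

(** The [k]-th set gets the budget [eps / 2 ^ S k], and the Cantor pairing merges the countably many
    covers into one. *)
Lemma small_covers_union s (A : nat -> R -> Prop) : (forall k, small_covers s (A k)) ->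
  small_covers s (fun x => exists k, A k x).
Proof.
  intros H delta eps Hd He.
  assert (H' : forall k, exists p : (nat -> R -> Prop) * (nat -> R),
    (forall x, A k x -> exists n, fst p n x) /\
    (forall n x y, fst p n x -> fst p n y -> Rabs (x - y) <= snd p n) /\
    (forall n, 0 <= snd p n <= delta) /\
    (forall n, psum (fun j => rpow (snd p j) s) n <= eps / 2 ^ S k)).
  { intros k. destruct (H k delta (eps / 2 ^ S k) Hd) as (U & c & HU).
    - apply Rdiv_lt_0_compat; auto. apply pow_lt; lra.
    - exists (U, c). exact HU. }
  pose (F := fun k => proj1_sig (constructive_indefinite_description _ (H' k))).
  assert (HF := fun k => proj2_sig (constructive_indefinite_description _ (H' k))).
  fold F in HF. change (forall k,
    (forall x, A k x -> exists n, fst (F k) n x) /\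
    (forall n x y, fst (F k) n x -> fst (F k) n y -> Rabs (x - y) <= snd (F k) n) /\
    (forall n, 0 <= snd (F k) n <= delta) /\
    (forall n, psum (fun j => rpow (snd (F k) j) s) n <= eps / 2 ^ S k)) in HF.
  exists (fun n => fst (F (fst (of_nat n))) (snd (of_nat n))),
    (fun n => snd (F (fst (of_nat n))) (snd (of_nat n))).
  split; [|split; [|split]].
  - intros x [k Hk]. destruct (HF k) as (H1 & _). destruct (H1 x Hk) as [n Hn].
    exists (to_nat (k, n)). rewrite cancel_of_to. exact Hn.
  - intros n. apply HF.
  - intros n. apply HF.
  - intros n. eapply Rle_trans; [apply (psum_cantor (fun i j => rpow (snd (F i) j) s))|].
    + intros; apply rpow_ge0.
    + eapply Rle_trans; [|apply (psum_halves eps n); lra].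
      apply psum_le. intros i _. apply HF.
Qed.

Lemma small_covers_or s (A A' : R -> Prop) : small_covers s A -> small_covers s A' ->
  small_covers s (fun x => A x \/ A' x).
Proof.
  intros H H'.
  apply small_covers_subset with (fun x => exists k : nat, (if (k =? 0)%nat then A else A') x).
  - intros x [Hx|Hx]; [exists 0%nat|exists 1%nat]; exact Hx.
  - apply small_covers_union. intros [|k]; auto.
Qed.

Lemma Rpower_pow_comm r s n : 0 < r -> Rpower (r ^ n) s = Rpower r s ^ n.
Proof.
  intros Hr. rewrite <- (Rpower_pow n r Hr), Rpower_mult.
  rewrite <- (Rpower_pow n (Rpower r s)) by apply exp_pos. rewrite Rpower_mult. f_equal. ring.
Qed.

(** Write [X = y * y]: by Bernoulli's inequality one factor [y ^ n] absorbs the linear term, and the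
    other still tends to infinity. *)
Lemma linear_over_geometric X C eps : 1 < X -> 0 < eps ->
  exists n0, forall n, (n0 <= n)%nat -> C * (INR n + 1) / X ^ n <= eps.
Proof.
  intros HX He. set (y := sqrt X).
  assert (Hy : 1 < y) by (unfold y; rewrite <- sqrt_1; apply sqrt_lt_1; lra).
  assert (HyX : X = y * y) by (unfold y; rewrite sqrt_sqrt; lra).
  set (G := Rabs C * (1 + / (y - 1))).
  assert (Hi : 0 < / (y - 1)) by (apply Rinv_0_lt_compat; lra).
  destruct (Pow_x_infinity y) with (b := G / eps) as [n0 Hn0].
  { rewrite Rabs_pos_eq; lra. }
  exists n0. intros n Hn. specialize (Hn0 n Hn).
  assert (Hp : 0 < y ^ n) by (apply pow_lt; lra). rewrite Rabs_pos_eq in Hn0 by lra.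
  assert (Hb : 1 + INR n * (y - 1) <= y ^ n).
  { replace y with (1 + (y - 1)) at 2 by ring. apply poly. lra. }
  assert (Hn1 : INR n + 1 <= (1 + / (y - 1)) * y ^ n).
  { apply Rle_trans with ((1 + / (y - 1)) * (1 + INR n * (y - 1))).
    - pose proof (pos_INR n).
      replace ((1 + / (y - 1)) * (1 + INR n * (y - 1))) with
        (1 + INR n + / (y - 1) + INR n * (y - 1)) by (field; lra).
      assert (0 <= INR n * (y - 1)) by (apply Rmult_le_pos; lra). lra.
    - apply Rmult_le_compat_l; lra. }
  rewrite HyX, Rpow_mult_distr.
  apply Rle_trans with (G / y ^ n).
  - unfold G. apply Rmult_le_reg_r with (y ^ n * y ^ n); [nra|].
    replace (C * (INR n + 1) / (y ^ n * y ^ n) * (y ^ n * y ^ n)) with (C * (INR n + 1)) by (field; lra).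
    replace (Rabs C * (1 + / (y - 1)) / y ^ n * (y ^ n * y ^ n))
      with (Rabs C * ((1 + / (y - 1)) * y ^ n)) by (field; lra).
    apply Rle_trans with (Rabs C * (INR n + 1)).
    + apply Rmult_le_compat_r; [pose proof (pos_INR n); lra|apply Rle_abs].
    + apply Rmult_le_compat_l; [apply Rabs_pos|auto].
  - apply Rmult_le_reg_r with (y ^ n); auto.
    unfold Rdiv at 1. rewrite Rmult_assoc, Rinv_l, Rmult_1_r by lra.
    apply Rge_le, Rmult_le_compat_r with (r := eps) in Hn0; [|lra].
    unfold Rdiv in Hn0. rewrite Rmult_assoc, Rinv_l in Hn0 by lra. lra.
Qed.

Lemma rpow_pos d s : 0 < d -> rpow d s = Rpower d s.
Proof. intros. unfold rpow. destruct Req_EM_T; auto; lra. Qed.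

Lemma rpow_0 s : 0 < s -> rpow 0 s = 0.
Proof. intros. unfold rpow. repeat destruct Req_EM_T; auto; lra. Qed.

(** At level [n] the cost is at most a constant times [(n + 1) (s / r ^ sigma) ^ n], which tends to
    0 because [s < r ^ sigma]; the linear factor in the count does no harm. *)
Lemma small_covers_of_count sigma (A : R -> Prop) C s r :
  0 < sigma -> 0 < C -> 1 < r -> 0 < s < Rpower r sigma ->
  (forall n, exists l : list (R -> Prop),
     INR (length l) <= C * (INR n + 1) * s ^ n /\
     (forall x, A x -> exists U, In U l /\ U x) /\
     (forall U, In U l -> forall x y, U x -> U y -> Rabs (x - y) <= C / r ^ n)) ->
  small_covers sigma A.
Proof.
  intros Hsg HC Hr Hs H delta eps Hd He.
  destruct (linear_over_geometric (Rpower r sigma / s) (C * Rpower C sigma) eps) as [n1 Hn1]; auto.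
  { apply Rmult_lt_reg_r with s; [lra|]. unfold Rdiv. rewrite Rmult_assoc, Rinv_l; lra. }
  destruct (linear_over_geometric r C delta Hr Hd) as [n2 Hn2].
  set (n := max n1 n2). specialize (Hn1 n (Nat.le_max_l _ _)). specialize (Hn2 n (Nat.le_max_r _ _)).
  destruct (H n) as (l & Hl & Hcov & Hdiam).
  assert (Hrn : 0 < r ^ n) by (apply pow_lt; lra).
  set (c0 := C / r ^ n). assert (Hc0 : 0 < c0) by (apply Rdiv_lt_0_compat; auto).
  (* Indices past the end of the list carry the empty set and the size bound 0, which costs nothing
     because [sigma > 0]. *)
  exists (fun k => nth k l (fun _ => False)), (fun k => if (k <? length l)%nat then c0 else 0).
  split; [|split; [|split]].
  - intros x Hx. destruct (Hcov x Hx) as (U & HU & HUx).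
    destruct (In_nth l U (fun _ => False) HU) as (k & _ & <-). exists k; auto.
  - intros k x y Hx Hy. destruct (k <? length l)%nat eqn:E.
    + apply Nat.ltb_lt in E. apply (Hdiam (nth k l (fun _ => False))); auto. apply nth_In; auto.
    + apply Nat.ltb_ge in E. rewrite nth_overflow in Hx by auto. tauto.
  - intros k. destruct (k <? length l)%nat; [|lra]. split; [lra|].
    eapply Rle_trans; [|apply Hn2]. unfold c0, Rdiv.
    apply Rmult_le_compat_r; [left; apply Rinv_0_lt_compat; auto|].
    pose proof (pos_INR n). nra.
  - assert (Hpow : forall k, psum (fun k => rpow (if (k <? length l)%nat then c0 else 0) sigma) k
        <= INR (length l) * Rpower c0 sigma).
    { intros k. assert (0 < Rpower c0 sigma) by apply exp_pos.
      destruct (Nat.le_ge_cases k (length l)) as [L|L].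
      - rewrite (psum_ext _ (fun _ => Rpower c0 sigma)).
        + rewrite psum_const. apply Rmult_le_compat_r; [lra|]. apply le_INR; auto.
        + intros i Hi. replace (i <? length l)%nat with true by (symmetry; apply Nat.ltb_lt; lia).
          apply rpow_pos; auto.
      - right. induction L.
        + rewrite (psum_ext _ (fun _ => Rpower c0 sigma)); [apply psum_const|].
          intros i Hi. replace (i <? length l)%nat with true by (symmetry; apply Nat.ltb_lt; lia).
          apply rpow_pos; auto.
        + cbn [psum]. rewrite IHL. replace (m <? length l)%nat with false by (symmetry; apply Nat.ltb_ge; lia).
          rewrite rpow_0; auto. lra. }
    intros k. eapply Rle_trans; [apply Hpow|]. eapply Rle_trans; [|apply Hn1].
    assert (E : Rpower c0 sigma = Rpower C sigma / Rpower r sigma ^ n).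
    { unfold c0, Rdiv. rewrite <- Rpower_mult_distr by (auto; apply Rinv_0_lt_compat; auto).
      f_equal. rewrite <- Rpower_pow_comm by lra. rewrite <- Rpower_Ropp.
      unfold Rpower. rewrite ln_Rinv by auto. f_equal. ring. }
    rewrite E. unfold Rdiv at 3. rewrite Rpow_mult_distr, pow_inv.
    assert (0 < s ^ n) by (apply pow_lt; lra).
    assert (0 < Rpower r sigma ^ n) by (apply pow_lt; lra).
    replace (C * Rpower C sigma * (INR n + 1) / (Rpower r sigma ^ n * / s ^ n))
      with (C * (INR n + 1) * s ^ n * (Rpower C sigma / Rpower r sigma ^ n)) by (field; lra).
    apply Rmult_le_compat_r; auto.
    left. apply Rdiv_lt_0_compat; auto. apply exp_pos.
Qed.

Lemma small_covers_subsingleton sigma (A : R -> Prop) : 0 < sigma ->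
  (forall x y, A x -> A y -> x = y) -> small_covers sigma A.
Proof.
  intros Hs H delta eps Hd He.
  exists (fun _ => A), (fun _ => 0). split; [|split; [|split]].
  - intros x Hx. exists 0%nat; auto.
  - intros _ x y Hx Hy. rewrite (H x y Hx Hy), Rminus_diag, Rabs_R0. lra.
  - intros _. lra.
  - intros n. rewrite rpow_0, psum_const by auto. lra.
Qed.

Lemma hausdorff_dim_le A D : 0 <= D -> (forall s, D < s -> hausdorff_null s A) ->
  Rbar_le (hausdorff_dim A) D.
Proof.
  intros HD H. unfold hausdorff_dim.
  pose proof (proj1 (Glb_Rbar_correct (fun s => 0 <= s /\ hausdorff_null s A))) as G.
  destruct (Glb_Rbar (fun s => 0 <= s /\ hausdorff_null s A)) as [b| |]; simpl; auto.
  - apply Rnot_lt_le; intros L. specialize (G ((b + D) / 2)). simpl in G.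
    assert (b <= (b + D) / 2); [|lra]. apply G. split; [lra|apply H; lra].
  - apply (G (D + 1)). split; [lra|apply H; lra].
Qed.

Lemma hausdorff_dim_ge A D : (forall s, 0 <= s < D -> ~ hausdorff_null s A) ->
  Rbar_le D (hausdorff_dim A).
Proof.
  intros H. apply (proj2 (Glb_Rbar_correct (fun s => 0 <= s /\ hausdorff_null s A))).
  intros s [Hs Hn]. simpl. apply Rnot_lt_le. intros L. apply (H s); auto.
Qed.

(** * Lower bounds from separated codings *)

(* The first [n] letters of [w], last letter first. *)
Fixpoint word (w : nat -> nat) (n : nat) : list nat :=
  match n with O => nil | S n => w n :: word w n end.

Lemma word_length w n : length (word w n) = n.
Proof. induction n; simpl; auto. Qed.

Lemma word_eq w w' n : (forall i, (i < n)%nat -> w i = w' i) -> word w n = word w' n.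
Proof. induction n; intros H; simpl; auto. rewrite IHn, H by (intros; try apply H; lia). auto. Qed.

Lemma psum_lt f g n : (0 < n)%nat -> (forall i, (i < n)%nat -> f i < g i) -> psum f n < psum g n.
Proof.
  destruct n as [|n]; intros L H; [lia|]. simpl.
  assert (f n < g n) by (apply H; lia).
  assert (psum f n <= psum g n) by (apply psum_le; intros; left; apply H; lia). lra.
Qed.

Lemma psum_single a v n : 0 <= v -> psum (fun i => if (i =? a)%nat then v else 0) n <= v.
Proof.
  intros Hv. assert (H : psum (fun i => if (i =? a)%nat then v else 0) n = if (a <? n)%nat then v else 0).
  { induction n; auto. cbn [psum]. rewrite IHn.
    destruct (Nat.ltb_spec a n), (Nat.ltb_spec a (S n)), (Nat.eqb_spec n a); try lia; lra. }
  rewrite H. destruct (a <? n)%nat; lra.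
Qed.

Lemma common_bound (Q : nat -> nat -> Prop) n :
  (forall a m m', (m <= m')%nat -> Q a m -> Q a m') ->
  (forall a, (a < n)%nat -> exists m, Q a m) -> exists m, forall a, (a < n)%nat -> Q a m.
Proof.
  intros Hm. induction n as [|n IH]; intros H; [exists 0%nat; intros; lia|].
  destruct IH as [m1 H1]; [intros; apply H; lia|]. destruct (H n) as [m2 H2]; [lia|].
  exists (max m1 m2). intros a Ha. destruct (Nat.eq_dec a n) as [->|].
  - apply Hm with m2; auto; lia.
  - apply Hm with m1; [lia|]. apply H1; lia.
Qed.

Section Kraft.
Variables (P : nat) (c : nat -> nat -> nat) (k : nat -> nat) (theta : R).
Hypotheses (HP : (1 <= P)%nat) (Htheta : theta < 1)
  (Hsum : forall m, psum (fun n => / INR P ^ k n) m <= theta).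

(** The share of the cylinder of [l] filled by the [n]-th forbidden cylinder under uniform measure,
    as long as [l] is a prefix of the latter; 0 otherwise. *)
Let weight (l : list nat) (n : nat) : R :=
  if excluded_middle_informative ((length l <= k n)%nat /\ word (c n) (length l) = l)
  then INR P ^ length l / INR P ^ k n else 0.

Let good (l : list nat) : Prop := forall m, psum (weight l) m <= theta.

Let HP' : 1 <= INR P.
Proof. apply (le_INR 1); auto. Qed.

Let weight_ge0 l n : 0 <= weight l n.
Proof.
  unfold weight. destruct excluded_middle_informative; [|lra].
  left. apply Rdiv_lt_0_compat; apply pow_lt; lra.
Qed.

Lemma good_nil : good nil.
Proof.
  intros m. eapply Rle_trans; [|apply (Hsum m)]. apply psum_le. intros i _.
  unfold weight. destruct excluded_middle_informative as [E|E].
  - simpl. unfold Rdiv. lra.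
  - left. apply Rinv_0_lt_compat, pow_lt. lra.
Qed.

(** Averaging over the next letter: a forbidden cylinder extending [l] survives for at most one
    letter, with its weight multiplied by [P], so the total weights of the [P] extensions sum to at
    most [P] times that of [l]. They cannot all exceed [theta]. *)
Lemma good_step l : good l -> exists a, (a < P)%nat /\ good (a :: l).
Proof.
  intros Hl. apply NNPP. intros N.
  (* One truncation index [m] must witness the excess for all letters at once, so that the finite
     sums can be exchanged. *)
  destruct (common_bound (fun a m => theta < psum (weight (a :: l)) m) P) as [m Hm].
  - intros a m m' L H. apply Rlt_le_trans with (1 := H). apply psum_incr; auto.
  - intros a Ha. apply NNPP. intros N'. apply N. exists a. split; auto.
    intros m. apply Rnot_lt_le. intros L. apply N'. exists m; auto.
  - apply psum_lt in Hm; [|lia].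
    rewrite psum_const, psum_exchange in Hm.
    assert (psum (fun j => psum (fun i => weight (i :: l) j) P) m <= INR P * psum (weight l) m).
    { rewrite <- psum_scal. apply psum_le. intros j _.
      eapply Rle_trans; [|apply (psum_single (c j (length l)) (INR P * weight l j) P)].
      - apply psum_le. intros a _. unfold weight at 1.
        destruct excluded_middle_informative as [[E1 E2]|].
        + simpl in E1, E2. injection E2 as E2 E3. rewrite E2, Nat.eqb_refl.
          unfold weight. destruct excluded_middle_informative as [|F].
          * right. cbn [length pow]. field. apply pow_nonzero. lra.
          * elim F. split; [lia|auto].
        + destruct (a =? c j (length l))%nat; [|lra]. apply Rmult_le_pos; auto; lra.
      - apply Rmult_le_pos; auto; lra. }
    specialize (Hl m). nra.
Qed.

Let next (l : list nat) : nat := epsilon (inhabits 0%nat) (fun a => (a < P)%nat /\ good (a :: l)).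

Fixpoint escape_word (n : nat) : list nat :=
  match n with O => nil | S n => next (escape_word n) :: escape_word n end.

(** Extending good prefixes for ever gives the word: had it entered the [n]-th cylinder, that
    cylinder would weigh 1 at length [k n], more than [theta]. This takes the place of a measure on
    the space of words. *)
Lemma kraft : exists w, (forall i, (w i < P)%nat) /\ forall n, word w (k n) <> word (c n) (k n).
Proof.
  set (w := fun n => next (escape_word n)).
  assert (Hw : forall n, word w n = escape_word n) by (induction n as [|n IH]; [|cbn [word escape_word]; rewrite IH]; reflexivity).
  assert (Hg : forall n, good (escape_word n)).
  { induction n; [apply good_nil|]. apply (epsilon_spec (inhabits 0%nat) _ (good_step _ IHn)). }
  exists w. split.
  - intros i. apply (epsilon_spec (inhabits 0%nat) _ (good_step _ (Hg i))).
  - intros n E. specialize (Hg (k n) (S n)). rewrite <- Hw, E in Hg.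
    pose proof (psum_term (weight (word (c n) (k n))) n (S n) (weight_ge0 _) (Nat.lt_succ_diag_r n)) as G.
    unfold weight at 1 in G. rewrite word_length in G.
    destruct excluded_middle_informative as [|F].
    + unfold Rdiv in G. rewrite Rinv_r in G by (apply pow_nonzero; lra). lra.
    + apply F; auto.
Qed.
End Kraft.

Lemma small_inverse_power x eta : 1 < x -> 0 < eta -> exists k, / x ^ k <= eta.
Proof.
  intros Hx He. destruct (Pow_x_infinity x) with (b := / eta) as [n Hn]; [rewrite Rabs_pos_eq; lra|].
  exists n. specialize (Hn n (Nat.le_refl n)). rewrite Rabs_pos_eq in Hn by (left; apply pow_lt; lra).
  rewrite <- (Rinv_inv eta). apply Rinv_le_contravar; [apply Rinv_0_lt_compat|]; lra.
Qed.

Section Separated.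
Variables (A : R -> Prop) (P : nat) (r c sigma : R) (X : (nat -> nat) -> R).
Hypotheses (HP : (2 <= P)%nat) (Hr : 1 < r) (Hc : 0 < c) (Hs : 0 <= sigma)
  (HrP : Rpower r sigma <= INR P)
  (HA : forall w, (forall i, (w i < P)%nat) -> A (X w))
  (Hsep : forall w w' j, (forall i, (w i < P)%nat) -> (forall i, (w' i < P)%nat) ->
     (forall i, (i < j)%nat -> w i = w' i) -> w j <> w' j -> c / r ^ j <= Rabs (X w - X w')).

(** By separation, a set of diameter [d] meets only points whose words agree on the first [k]
    letters, where [k] is least with [c / r ^ k <= d]. Then [P ^ -k <= r ^ (- k sigma) <= c ^ (-
    sigma) d ^ sigma]. The slack [eta] pays for sets that cost nothing or miss the coded points. *)
Lemma cylinder_of_cover (U : R -> Prop) eta : 0 < eta -> Rbar_le (diam U) 1 ->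
  exists (w0 : nat -> nat) (k : nat),
    (forall w, (forall i, (w i < P)%nat) -> U (X w) -> word w k = word w0 k) /\
    / INR P ^ k <= (Rpower c (- sigma) + 1) * diam_pow sigma U + eta.
Proof.
  intros He HU.
  assert (HP' : 2 <= INR P) by (apply (le_INR 2); auto).
  assert (HG : 1 <= Rpower c (- sigma) + 1) by (pose proof (exp_pos (- sigma * ln c)); unfold Rpower; lra).
  assert (HD : 0 <= diam_pow sigma U) by apply diam_pow_ge0.
  destruct (small_inverse_power (INR P) eta) as [k0 Hk0]; [lra|auto|].
  destruct (classic (exists w, (forall i, (w i < P)%nat) /\ U (X w))) as [[w0 [Hw0 HU0]]|N].
  2:{ exists (fun _ => 0%nat), k0. split; [intros w H1 H2; elim N; eauto|]. nra. }
  exists w0.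
  assert (Hd : exists d, diam U = Finite d /\ forall w, (forall i, (w i < P)%nat) -> U (X w) -> Rabs (X w - X w0) <= d).
  { destruct (diam U) as [d| |] eqn:E; [|elim HU|].
    - exists d. split; auto. intros w Hw Hx. pose proof (diam_ge U _ _ Hx HU0) as G. rewrite E in G. exact G.
    - pose proof (diam_ge U _ _ HU0 HU0) as G. rewrite E in G. elim G. }
  destruct Hd as (d & Ed & Hd).
  assert (Hd0 : 0 <= d) by (specialize (Hd w0 Hw0 HU0); pose proof (Rabs_pos (X w0 - X w0)); lra).
  assert (Hagree : forall k, (forall j, (j < k)%nat -> d < c / r ^ j) ->
    forall w, (forall i, (w i < P)%nat) -> U (X w) -> word w k = word w0 k).
  { intros k Hk w Hw Hx. apply word_eq. apply NNPP. intros N.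
    destruct (first_difference w w0) as (j & Hj & Hlt).
    { apply NNPP; intros N'. apply N. intros i _. apply NNPP; intros N''. apply N'; eauto. }
    assert (Hjk : (j < k)%nat).
    { apply Nat.nle_gt. intros L. apply N. intros i Hi. apply Hlt. lia. }
    specialize (Hsep w w0 j Hw Hw0 Hlt Hj). specialize (Hd w Hw Hx). specialize (Hk j Hjk). lra. }
  unfold diam_pow in *. rewrite Ed in *. unfold rpow in *.
  (* A single point costs [rpow 0 0 = 1] when [sigma = 0], which pays for the trivial cylinder; this
     is where the summand 1 in the constant is used. For [sigma > 0] it costs 0, and a long cylinder
     is paid by [eta]. *)
  destruct (Req_EM_T d 0) as [Ed0|Ed0].
  - destruct (Req_EM_T sigma 0).
    + exists 0%nat. split; [auto|]. simpl. lra.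
    + exists k0. split; [|nra]. apply Hagree. intros j _. rewrite Ed0.
      apply Rdiv_lt_0_compat; auto. apply pow_lt; lra.
  - assert (Hk : exists k, c / r ^ k <= d /\ forall j, (j < k)%nat -> d < c / r ^ j).
    { destruct (small_inverse_power r (d / c)) as [n Hn]; [auto|apply Rdiv_lt_0_compat; lra|].
      assert (Hn' : c / r ^ n <= d).
      { apply Rmult_le_compat_l with (r := c) in Hn; [|lra].
        replace (c * (d / c)) with d in Hn by (field; lra). exact Hn. }
      clear Hn. induction n as [|n IH].
      - exists 0%nat. split; auto. intros; lia.
      - destruct (Rle_lt_dec (c / r ^ n) d) as [L|L]; auto.
        exists (S n). split; auto. intros j Hj. apply Rlt_le_trans with (1 := L).
        apply Rmult_le_compat_l; [lra|]. apply Rinv_le_contravar; [apply pow_lt; lra|].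
        apply Rle_pow; [lra|lia]. }
    destruct Hk as (k & Hk1 & Hk2). exists k. split; [apply Hagree, Hk2|].
    assert (Hrk : 0 < r ^ k) by (apply pow_lt; lra).
    assert (H1 : / INR P ^ k <= / Rpower r sigma ^ k).
    { apply Rinv_le_contravar; [apply pow_lt, exp_pos|]. apply pow_incr. split; auto.
      left; apply exp_pos. }
    assert (H2 : / Rpower r sigma ^ k <= Rpower c (- sigma) * Rpower d sigma).
    { rewrite <- Rpower_pow_comm by lra. rewrite <- Rpower_Ropp.
      replace (Rpower (r ^ k) (- sigma)) with (Rpower c (- sigma) * Rpower (c / r ^ k) sigma).
      - apply Rmult_le_compat_l; [left; apply exp_pos|]. apply Rle_Rpower_l; auto.
        split; auto. apply Rdiv_lt_0_compat; auto.
      - unfold Rpower. rewrite <- exp_plus, ln_div by auto. f_equal. ring. }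
    pose proof (exp_pos (sigma * ln d)). fold (Rpower d sigma) in H. lra.
Qed.

(** A cover of cost below [1 / (4 G)] would yield cylinders of total weight at most [1 / 4 + 1 / 4],
    the second quarter being the sum of the slacks. By [kraft] some word avoids them all, and its
    point is not covered. *)
Lemma not_null_of_separated : ~ hausdorff_null sigma A.
Proof.
  intros Hnull. specialize (Hnull 1 Rlt_0_1).
  set (G := Rpower c (- sigma) + 1).
  assert (HG : 1 <= G) by (pose proof (exp_pos (- sigma * ln c)); unfold G, Rpower; lra).
  assert (HGi : 0 < / (4 * G)) by (apply Rinv_0_lt_compat; lra).
  assert (Hv : exists v, v < / (4 * G) /\ exists U : nat -> R -> Prop,
    (forall x, A x -> exists n, U n x) /\
    (forall n, Rbar_le (diam (U n)) (Finite 1)) /\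
    is_series (fun n => diam_pow sigma (U n)) v).
  { apply NNPP. intros N. unfold hausdorff_content in Hnull.
    match type of Hnull with Glb_Rbar ?E = _ =>
      pose proof (proj2 (Glb_Rbar_correct E) (Finite (/ (4 * G)))) as L end.
    rewrite Hnull in L. simpl in L. apply Rle_not_lt in L; auto.
    intros v Hv. apply Rnot_lt_le. intros Lt. apply N. exists v. auto. }
  destruct Hv as (v & Hv & U & HU1 & HU2 & HU3).
  assert (HC : forall n, exists p : (nat -> nat) * nat,
    (forall w, (forall i, (w i < P)%nat) -> U n (X w) -> word w (snd p) = word (fst p) (snd p)) /\
    / INR P ^ (snd p) <= G * diam_pow sigma (U n) + / 4 / 2 ^ S n).
  { intros n. destruct (cylinder_of_cover (U n) (/ 4 / 2 ^ S n)) as (w0 & k & H); auto.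
    - apply Rdiv_lt_0_compat; [lra|apply pow_lt; lra].
    - exists (w0, k). exact H. }
  pose (F := fun n => proj1_sig (constructive_indefinite_description _ (HC n))).
  assert (HF := fun n => proj2_sig (constructive_indefinite_description _ (HC n))).
  change (forall n,
    (forall w, (forall i, (w i < P)%nat) -> U n (X w) -> word w (snd (F n)) = word (fst (F n)) (snd (F n))) /\
    / INR P ^ (snd (F n)) <= G * diam_pow sigma (U n) + / 4 / 2 ^ S n) in HF.
  destruct (kraft P (fun n => fst (F n)) (fun n => snd (F n)) (1 / 2)) as (w & Hw & Hesc).
  - lia.
  - lra.
  - intros m. apply Rle_trans with (psum (fun n => G * diam_pow sigma (U n) + / 4 / 2 ^ S n) m).
    + apply psum_le. intros i _. apply HF.
    + rewrite psum_plus, psum_scal.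
      pose proof (psum_halves (/ 4) m).
      assert (psum (fun n => diam_pow sigma (U n)) m <= v).
      { apply psum_le_series; auto. intros; apply diam_pow_ge0. }
      assert (G * psum (fun n => diam_pow sigma (U n)) m <= G * / (4 * G)).
      { apply Rmult_le_compat_l; lra. }
      replace (G * / (4 * G)) with (/ 4) in H1 by (field; lra). lra.
  - destruct (HU1 (X w) (HA w Hw)) as [n Hn]. apply (Hesc n). apply HF; auto.
Qed.
End Separated.

(** * Counting admissible words *)

Lemma ln_le_sub1 x : 0 < x -> ln x <= x - 1.
Proof. intros Hx. pose proof (exp_ineq1_le (ln x)). rewrite exp_ln in H by auto. lra. Qed.

(** The graph of [u -> u ^ D] lies below its tangent at 1. In logarithms: add [ln x <= x - 1] at
    [u / T] and at [1 / T] with weights [D] and [1 - D]; the right sides cancel. *)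
Lemma Rpower_tangent u D : 0 < u -> 0 <= D <= 1 -> Rpower u D <= 1 + D * (u - 1).
Proof.
  intros Hu HD. set (T := 1 + D * (u - 1)). assert (HT : 0 < T) by (unfold T; nra).
  unfold Rpower. rewrite <- (exp_ln T HT) at 1.
  assert (H : D * ln u <= ln T); [|destruct H as [H|H]; [left; apply exp_increasing; auto|right; congruence]].
  pose proof (ln_le_sub1 (u / T)) as H1. pose proof (ln_le_sub1 (1 / T)) as H2.
  rewrite ln_div in H1, H2 by lra. rewrite ln_1 in H2.
  assert (H3 : D * (ln u - ln T) <= D * (u / T - 1)) by (apply Rmult_le_compat_l; [lra|]; apply H1, Rdiv_lt_0_compat; auto).
  assert (H4 : (1 - D) * (0 - ln T) <= (1 - D) * (1 / T - 1)) by (apply Rmult_le_compat_l; [lra|]; apply H2, Rdiv_lt_0_compat; lra).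
  assert (E : D * (u / T - 1) + (1 - D) * (1 / T - 1) = 0) by (unfold T; field; fold T; lra).
  lra.
Qed.

Lemma Rpower_concave x y a D : 0 < x -> 0 < y -> 0 <= a <= 1 -> 0 <= D <= 1 ->
  a * Rpower x D + (1 - a) * Rpower y D <= Rpower (a * x + (1 - a) * y) D.
Proof.
  intros Hx Hy Ha HD. set (z := a * x + (1 - a) * y).
  assert (Hz : 0 < z) by (unfold z; destruct (Req_dec a 0) as [->|]; nra).
  assert (H : forall v, 0 < v -> Rpower v D <= Rpower z D * (1 + D * (v / z - 1))).
  { intros v Hv. replace v with (z * (v / z)) at 1 by (field; lra).
    assert (0 < v / z) by (apply Rdiv_lt_0_compat; auto).
    rewrite <- Rpower_mult_distr by auto.
    apply Rmult_le_compat_l; [left; apply exp_pos|]. apply Rpower_tangent; auto. }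
  pose proof (Rmult_le_compat_l a _ _ (proj1 Ha) (H x Hx)).
  assert (Ha' : 0 <= 1 - a) by lra.
  pose proof (Rmult_le_compat_l (1 - a) _ _ Ha' (H y Hy)).
  assert (E : a * (Rpower z D * (1 + D * (x / z - 1))) + (1 - a) * (Rpower z D * (1 + D * (y / z - 1)))
    = Rpower z D * (1 + D * ((a * x + (1 - a) * y) / z - 1))) by (field; lra).
  fold z in E. replace (z / z) with 1 in E by (field; lra). lra.
Qed.

Lemma Rpower_one_l D : Rpower 1 D = 1.
Proof. unfold Rpower. rewrite ln_1, Rmult_0_r. apply exp_0. Qed.

(** Since [1 ^ D = 1] and [B ^ D = N], the chord over [[1, B]] runs from 1 to [N]; concavity puts
    the graph above it at the point where the chord has height [j]. *)
Lemma Rpower_chord B N D j : 1 < B -> 1 < N -> 0 <= D <= 1 -> Rpower B D = N -> 1 <= j <= N ->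
  j <= Rpower (1 + (j - 1) * ((B - 1) / (N - 1))) D.
Proof.
  intros HB HN HD HBN Hj.
  pose proof (Rpower_concave 1 B ((N - j) / (N - 1)) D) as H.
  assert (Hi : 0 < / (N - 1)) by (apply Rinv_0_lt_compat; lra).
  assert (E1 : (N - j) / (N - 1) = 1 - (j - 1) / (N - 1)) by (field; lra).
  assert (0 <= (j - 1) / (N - 1)) by (apply Rmult_le_pos; lra).
  assert (0 <= (N - j) / (N - 1)) by (apply Rmult_le_pos; lra).
  rewrite Rpower_one_l, HBN in H.
  replace ((N - j) / (N - 1) * 1 + (1 - (N - j) / (N - 1)) * N) with j in H by (field; lra).
  replace ((N - j) / (N - 1) * 1 + (1 - (N - j) / (N - 1)) * B)
    with (1 + (j - 1) * ((B - 1) / (N - 1))) in H by (field; lra).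
  apply H; lra.
Qed.

(** The pairs [w, 1 + a] and [1, a + w] have equal sums and the second is nested inside the first,
    so concavity gives it the larger sum of powers. *)
Lemma Rpower_increment a w D : 0 < a -> 0 < w <= 1 -> 0 <= D <= 1 ->
  Rpower (1 + a) D + Rpower w D <= Rpower (a + w) D + 1.
Proof.
  intros Ha Hw HD.
  set (b := (1 - w) / (1 + a - w)).
  assert (Hi : 0 < / (1 + a - w)) by (apply Rinv_0_lt_compat; lra).
  assert (Hb : 0 <= b <= 1).
  { split; unfold b; [apply Rmult_le_pos; lra|].
    apply Rmult_le_reg_r with (1 + a - w); [lra|]. unfold Rdiv. rewrite Rmult_assoc, Rinv_l; lra. }
  pose proof (Rpower_concave w (1 + a) b D) as H1.
  pose proof (Rpower_concave w (1 + a) (1 - b) D) as H2.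
  replace (b * w + (1 - b) * (1 + a)) with (a + w) in H1 by (unfold b; field; lra).
  replace ((1 - b) * w + (1 - (1 - b)) * (1 + a)) with 1 in H2 by (unfold b; field; lra).
  rewrite Rpower_one_l in H2. lra.
Qed.

(* Words with value below [z] start either with one of [m] digits followed by any
   admissible word, or with [m] followed by a word of value below [p z - m]; so
   [z -> (z / Z) ^ D] dominates their number, normalised by [p ^ (n D)]. *)
Lemma supersolution p B N D Z z m :
  1 < p <= B -> 1 <= N <= B -> 0 <= D <= 1 -> Rpower B D = N ->
  Z = 1 - (B - N) / (p - 1) -> 0 < z <= Z ->
  m = 0 \/ 1 <= m <= N - 1 -> m < p * z ->
  m + Rpower (Rmin Z (p * z - m) / Z) D <= Rpower p D * Rpower (z / Z) D.
Proof.
  intros Hp HN HD HBN HZ Hz Hm Hmz.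
  set (z' := Rmin Z (p * z - m)).
  assert (Hz'0 : 0 < z') by (unfold z'; apply Rmin_glb_lt; lra).
  assert (Hz'1 : z' <= Z) by apply Rmin_l.
  assert (Hz'2 : z' <= p * z - m) by apply Rmin_r.
  assert (HiZ : 0 < / Z) by (apply Rinv_0_lt_compat; lra).
  rewrite Rpower_mult_distr; [|lra|apply Rdiv_lt_0_compat; lra].
  replace (p * (z / Z)) with (p * z * / Z) by (field; lra).
  destruct Hm as [->|Hm].
  - rewrite Rplus_0_l. apply Rle_Rpower_l; [lra|]. split; [apply Rdiv_lt_0_compat; lra|].
    apply Rmult_le_compat_r; lra.
  - set (w := z' / Z).
    assert (Hw : 0 < w <= 1).
    { split; [apply Rdiv_lt_0_compat; lra|]. unfold w. apply Rmult_le_reg_r with Z; [lra|].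
      unfold Rdiv. rewrite Rmult_assoc, Rinv_l; lra. }
    (* By [Rpower_chord], [(1 + a) ^ D >= m + 1]. Since [p <= B] gives [Z <= (N - 1) / (B - 1)],
       also [a <= m / Z], hence [a + w <= p z / Z]; [Rpower_increment] joins the two estimates. *)
    set (a := m * ((B - 1) / (N - 1))).
    assert (HiN : 0 < / (N - 1)) by (apply Rinv_0_lt_compat; lra).
    assert (Ha0 : 0 < a).
    { apply Rmult_lt_0_compat; [lra|]. apply Rdiv_lt_0_compat; lra. }
    assert (HaZ : a <= m * / Z).
    { apply Rmult_le_compat_l; [lra|]. apply Rmult_le_reg_r with Z; [lra|].
      rewrite Rinv_l by lra.
      assert (HZle : Z <= (N - 1) / (B - 1)).
      { rewrite HZ. replace ((N - 1) / (B - 1)) with (1 - (B - N) / (B - 1)) by (field; lra).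
        assert ((B - N) / (B - 1) <= (B - N) / (p - 1)); [|lra].
        apply Rmult_le_compat_l; [lra|]. apply Rinv_le_contravar; lra. }
      apply Rle_trans with ((B - 1) / (N - 1) * ((N - 1) / (B - 1))).
      - apply Rmult_le_compat_l; auto. left; apply Rdiv_lt_0_compat; lra.
      - right. field. lra. }
    pose proof (Rpower_chord B N D (m + 1)) as H1.
    replace (m + 1 - 1) with m in H1 by ring. fold a in H1.
    pose proof (Rpower_increment a w D Ha0 Hw HD) as H2.
    assert (H3 : Rpower (a + w) D <= Rpower (p * z * / Z) D).
    { apply Rle_Rpower_l; [lra|]. split; [lra|].
      assert (w <= (p * z - m) * / Z) by (apply Rmult_le_compat_r; lra). lra. }
    fold w. lra.
Qed.

(** * Lists of admissible prefixes *)

Fixpoint prefix (n : nat) (d : nat -> nat) : list nat :=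
  match n with O => nil | S n => d 0%nat :: prefix n (tail 1 d) end.

Lemma prefix_eq n : forall d e, prefix n d = prefix n e -> forall i, (i < n)%nat -> d i = e i.
Proof.
  induction n as [|n IH]; intros d e H i Hi; [lia|]. simpl in H. injection H as H1 H2.
  destruct i as [|i]; auto. apply (IH (tail 1 d) (tail 1 e) H2 i). lia.
Qed.

Lemma largest_below n y : 0 < y ->
  exists k, (k <= n)%nat /\ INR k < y /\ forall j, (j <= n)%nat -> INR j < y -> (j <= k)%nat.
Proof.
  intros Hy. induction n as [|n (k & H1 & H2 & H3)].
  - exists 0%nat. repeat split; auto.
  - destruct (Rlt_dec (INR (S n)) y) as [L|L].
    + exists (S n). auto.
    + exists k. repeat split; auto. intros j Hj Hjy. apply H3; auto.
      destruct (Nat.eq_dec j (S n)) as [->|]; [contradiction|lia].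
Qed.

Lemma length_flat_map_const {T U} (f : T -> list U) k l : (forall x, length (f x) = k) ->
  length (flat_map f l) = (length l * k)%nat.
Proof. intros H. induction l; simpl; auto. rewrite length_app, H, IHl. auto. Qed.

Section Count.
Variables (p B D Z : R) (N : nat).
Hypotheses (Hp : 1 < p <= B) (HN : 1 <= INR N <= B) (HD : 0 <= D <= 1)
  (HBN : Rpower B D = INR N) (HZ : Z = 1 - (B - INR N) / (p - 1)).

Let s := Rpower p D.

Let s_ge1 : 1 <= s.
Proof. unfold s. rewrite <- (Rpower_O p) by lra. apply Rle_Rpower; lra. Qed.

(** Induction on [n], splitting by the first digit: below [m], the largest digit less than [p z],
    any admissible tail is allowed, while after [m] the tail must stay below [p z - m]. The summand
    1 is needed for the empty prefix, since [z / Z] may be tiny. *)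
Lemma count_prefixes_below n : forall z, 0 < z <= Z ->
  exists l : list (list nat), INR (length l) <= INR n * s ^ n * Rpower (z / Z) D + 1 /\
    forall e, bounded (N - 1) e -> (forall i, dval p (tail i e) < Z) -> dval p e < z ->
      In (prefix n e) l.
Proof.
  induction n as [|n IH]; intros z Hz.
  { exists (nil :: nil). split; [simpl; lra|]. intros; left; reflexivity. }
  destruct (largest_below (N - 1) (p * z)) as (m & Hm1 & Hm2 & Hm3); [nra|].
  assert (HN1 : INR (N - 1) = INR N - 1).
  { rewrite minus_INR; [auto|]. apply INR_le. simpl; lra. }
  assert (Hm : INR m = 0 \/ 1 <= INR m <= INR N - 1).
  { destruct m; [left; auto|right]. split; [apply (le_INR 1); lia|]. rewrite <- HN1. apply le_INR; auto. }
  pose proof (supersolution p B (INR N) D Z z (INR m) Hp HN HD HBN HZ Hz Hm Hm2) as Hsup.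
  set (z' := Rmin Z (p * z - INR m)) in *.
  destruct (IH Z) as (l1 & Hl1 & Hc1); [lra|].
  destruct (IH z') as (l2 & Hl2 & Hc2).
  { split; [apply Rmin_glb_lt; lra|apply Rmin_l]. }
  exists (flat_map (fun a => map (cons a) l1) (seq 0 m) ++ map (cons m) l2). split.
  - rewrite length_app, (length_flat_map_const _ (length l1)), length_map, length_seq, plus_INR, mult_INR
      by (intros; apply length_map).
    replace (Z / Z) with 1 in Hl1 by (field; lra). rewrite Rpower_one_l in Hl1.
    fold s in Hsup. set (g := Rpower (z / Z) D) in *. set (g' := Rpower (z' / Z) D) in *.
    assert (0 < g) by apply exp_pos. assert (0 < g') by apply exp_pos.
    pose proof (pos_INR m). pose proof (pos_INR n).
    assert (Hsn : 1 <= s ^ n) by (apply pow_R1_Rle; auto).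
    set (b := INR n * s ^ n) in *. assert (0 <= b) by (apply Rmult_le_pos; lra).
    (* The [m] copies of the recursive bound each bring a summand 1. These add up to [m <= s g],
       which fits into the extra term gained in passing from [n] to [S n]. *)
    apply Rle_trans with (b * (INR m + g') + INR m + 1).
    { assert (INR m * INR (length l1) <= INR m * (b * 1 + 1)) by (apply Rmult_le_compat_l; auto). lra. }
    assert (b * (INR m + g') <= b * (s * g)) by (apply Rmult_le_compat_l; auto).
    replace (INR (S n) * s ^ S n * g) with (b * (s * g) + s ^ n * (s * g))
      by (rewrite S_INR; unfold b; simpl; ring).
    assert (1 * (s * g) <= s ^ n * (s * g)) by (apply Rmult_le_compat_r; [nra|auto]). lra.
  - intros e He Ht Hez. simpl.
    pose proof (dval_tail (N - 1) p e 0 (proj1 Hp) He) as E.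
    change (tail 0 e) with e in E.
    pose proof (dval_ge0 (N - 1) p (tail 1 e) (proj1 Hp) (bounded_tail _ _ _ He)).
    assert (p * dval p e < p * z) by (apply Rmult_lt_compat_l; lra).
    assert (L : (e 0 <= m)%nat) by (apply Hm3; auto; lra).
    apply in_app_iff. destruct (Nat.eq_dec (e 0%nat) m) as [E0|E0].
    + right. rewrite E0. apply in_map. apply Hc2; [apply bounded_tail; auto|intros i; apply (Ht (S i))|].
      rewrite E0 in E. apply Rmin_glb_lt; [apply (Ht 1%nat)|lra].
    + left. apply in_flat_map. exists (e 0%nat). split; [apply in_seq; lia|].
      apply in_map, Hc1; [apply bounded_tail; auto|intros i; apply (Ht (S i))|apply (Ht 1%nat)].
Qed.

Lemma count_prefixes n : 0 < Z ->
  exists l : list (list nat), INR (length l) <= (INR n + 1) * s ^ n /\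
    forall e, bounded (N - 1) e -> (forall i, dval p (tail i e) < Z) -> In (prefix n e) l.
Proof.
  intros HZ0. destruct (count_prefixes_below n Z) as (l & Hl & Hc); [lra|].
  exists l. split.
  - replace (Z / Z) with 1 in Hl by (field; lra). rewrite Rpower_one_l in Hl.
    assert (1 <= s ^ n) by (apply pow_R1_Rle; auto). lra.
  - intros e He Ht. apply Hc; auto. apply (Ht 0%nat).
Qed.
End Count.

Lemma dval_shift M q e k : 1 < q -> bounded M e ->
  dval q (fun n => e n + k)%nat = dval q e + INR k / (q - 1).
Proof.
  intros Hq He. rewrite <- dval_const by auto. unfold dval. rewrite <- Series_plus.
  - apply Series_ext. intros n. rewrite plus_INR. unfold Rdiv; ring.
  - apply (ex_series_digits M); auto.
  - apply (ex_series_digits k); auto. intros ?; auto.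
Qed.

(* Truncated subtraction makes this [1] when [2 * K < M]. *)
Definition core_size (K M : nat) : nat := S (2 * K - M).

Definition core_dim (K M : nat) : R := ln (INR (core_size K M)) / ln (INR K + 1).

(** The trace left in its tails by a unique expansion in a base at most [K + 1]. For bases of 1, [p]
    may exceed the base of the expansion, so that one count serves a whole interval of bases. *)
Definition inner (K M : nat) (p : R) (d : nat -> nat) : Prop :=
  (forall i, M - K <= d i <= K)%nat /\ forall i, dval p (tail i d) < 1.

Lemma core_dim_spec K M : (1 <= K <= M)%nat ->
  1 <= INR (core_size K M) <= INR K + 1 /\ 0 <= core_dim K M <= 1 /\
  Rpower (INR K + 1) (core_dim K M) = INR (core_size K M).
Proof.
  intros HK. unfold core_dim. set (N := core_size K M).
  assert (HKr : 1 <= INR K) by (apply (le_INR 1); lia).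
  assert (HN1 : 1 <= INR N) by (apply (le_INR 1); unfold N, core_size; lia).
  assert (HN2 : INR N <= INR K + 1) by (rewrite <- S_INR; apply le_INR; unfold N, core_size; lia).
  assert (HlB : 0 < ln (INR K + 1)) by (rewrite <- ln_1; apply ln_increasing; lra).
  assert (HlN : 0 <= ln (INR N)) by (rewrite <- ln_1; apply ln_le; lra).
  assert (HlNB : ln (INR N) <= ln (INR K + 1)) by (apply ln_le; lra).
  assert (Hi : 0 < / ln (INR K + 1)) by (apply Rinv_0_lt_compat; auto).
  repeat split; auto.
  - apply Rmult_le_pos; lra.
  - apply Rmult_le_reg_r with (ln (INR K + 1)); auto. unfold Rdiv. rewrite Rmult_assoc, Rinv_l; lra.
  - unfold Rpower, Rdiv. rewrite Rmult_assoc, Rinv_l, Rmult_1_r by lra. apply exp_ln. lra.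
Qed.

Lemma prefix_map f n : forall d, prefix n (fun i => f (d i)) = map f (prefix n d).
Proof. induction n; intros d; simpl; auto. f_equal. apply (IHn (tail 1 d)). Qed.

Lemma prefix_ext n : forall d e, (forall i, d i = e i) -> prefix n d = prefix n e.
Proof. induction n; intros d e H; simpl; auto. f_equal; auto. apply IHn. intros i; apply H. Qed.

(** Subtracting [M - K] from every digit turns inner sequences into sequences over [N] digits and
    lowers all tail values by [(M - K) / (p - 1)], so the bound 1 becomes [Z]. *)
Lemma count_inner K M p n : (1 <= K <= M)%nat -> 1 < p <= INR K + 1 ->
  exists l : list (list nat),
    INR (length l) <= (INR n + 1) * Rpower p (core_dim K M) ^ n /\
    forall d, inner K M p d -> In (prefix n d) l.
Proof.
  intros HK Hp.
  destruct (core_dim_spec K M HK) as (HN & HD & HBN).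
  set (N := core_size K M) in *. set (D := core_dim K M) in *.
  destruct (classic (exists d, inner K M p d)) as [[d0 [Hd0 Ht0]]|NE].
  2:{ exists nil. split; [|intros d Hd; elim NE; eauto]. simpl.
      apply Rmult_le_pos; [pose proof (pos_INR n); lra|]. apply pow_le. left; apply exp_pos. }
  (* A single inner sequence already shows that the digit interval is nonempty, so the truncated
     subtraction in [core_size] is exact; its value also gives [Z > 0] below. *)
  assert (HMK : (M <= 2 * K)%nat) by (specialize (Hd0 0%nat); lia).
  assert (HNr : INR K + 1 - INR N = INR (M - K)).
  { rewrite <- S_INR, <- minus_INR by (unfold N, core_size; lia). f_equal. unfold N, core_size. lia. }
  set (Z := 1 - (INR K + 1 - INR N) / (p - 1)).
  assert (Hshift : forall d, inner K M p d ->
    bounded (N - 1) (fun i => d i - (M - K))%nat /\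
    forall i, dval p (tail i (fun i => d i - (M - K))%nat) < Z).
  { intros d [Hd Ht].
    assert (Hb : bounded (N - 1) (fun i => d i - (M - K))%nat).
    { intros i. specialize (Hd i). unfold N, core_size. lia. }
    split; auto. intros i. specialize (Ht i).
    rewrite (dval_ext p (tail i d) (fun n => tail i (fun i => d i - (M - K)) n + (M - K))%nat) in Ht.
    - rewrite (dval_shift (N - 1)) in Ht by (auto using bounded_tail; lra).
      unfold Z. rewrite HNr. lra.
    - intros j. unfold tail. specialize (Hd (i + j)%nat). lia. }
  destruct (count_prefixes p (INR K + 1) D Z N Hp HN HD HBN eq_refl n) as (l & Hl & Hc).
  { destruct (Hshift d0) as [Hb Ht]; [split; auto|]. specialize (Ht 0%nat).
    pose proof (dval_ge0 (N - 1) p _ (proj1 Hp) Hb).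
    change (tail 0 (fun i => d0 i - (M - K))%nat) with (fun i => d0 i - (M - K))%nat in Ht. lra. }
  exists (map (map (fun k => k + (M - K))%nat) l). rewrite length_map. split; auto.
  intros d Hd. destruct (Hshift d Hd) as [Hb Ht].
  rewrite (prefix_ext n d (fun i => (fun k => k + (M - K)) (d i - (M - K)))%nat).
  - rewrite (prefix_map (fun k => k + (M - K))%nat). apply in_map, Hc; auto.
  - intros i. destruct Hd as [Hd _]. specialize (Hd i). lia.
Qed.

(** * Upper bounds *)

Fixpoint words (M k : nat) : list (list nat) :=
  match k with
  | O => nil :: nil
  | S k => flat_map (fun a => map (cons a) (words M k)) (seq 0 (S M))
  end.

Lemma words_length M k : length (words M k) = (S M ^ k)%nat.
Proof.
  induction k; cbn [words]; auto.
  rewrite (length_flat_map_const _ (length (words M k))), length_seq, IHk; auto.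
  intros; apply length_map.
Qed.

Lemma in_words M k : forall d, bounded M d -> In (prefix k d) (words M k).
Proof.
  induction k as [|k IH]; intros d Hd; cbn [words prefix]; [left; auto|].
  apply in_flat_map. exists (d 0%nat). split; [|apply in_map, IH, bounded_tail; auto].
  apply in_seq. specialize (Hd 0%nat). lia.
Qed.

(** Group points by [k] arbitrary digits followed by [n] digits of an inner sequence. The count
    grows like [p ^ (n D)] and the diameters shrink like [r ^ -n]; keeping [p] and [r] apart serves
    the parameter space, where bases vary between them. *)
Lemma small_covers_coded K M k p r sigma C0 (A : R -> Prop) (code : R -> (nat -> nat) -> Prop) :
  (1 <= K <= M)%nat -> 1 < p <= INR K + 1 -> 1 < r -> 0 < sigma -> 0 <= C0 ->
  Rpower p (core_dim K M) < Rpower r sigma ->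
  (forall x, A x -> exists d, bounded M d /\ code x d /\ inner K M p (tail k d)) ->
  (forall n x y d e, code x d -> code y e -> (forall i, (i < k + n)%nat -> d i = e i) ->
     Rabs (x - y) <= C0 / r ^ n) ->
  small_covers sigma A.
Proof.
  intros HK Hp Hr Hs HC0 Hpr HA Hcode.
  set (W := INR (S M ^ k)).
  assert (HW : 1 <= W).
  { unfold W. rewrite pow_INR. apply pow_R1_Rle. rewrite S_INR. pose proof (pos_INR M). lra. }
  apply small_covers_of_count with (C := W * (1 + C0)) (s := Rpower p (core_dim K M)) (r := r); auto; try nra.
  { split; auto. apply exp_pos. }
  intros n. destruct (count_inner K M p n HK Hp) as (l & Hl & Hc).
  exists (map (fun wv x => exists d, code x d /\ prefix k d = fst wv /\ prefix n (tail k d) = snd wv)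
    (list_prod (words M k) l)).
  split; [|split].
  - rewrite length_map, length_prod, words_length, mult_INR. fold W.
    assert (0 < Rpower p (core_dim K M) ^ n) by (apply pow_lt, exp_pos).
    pose proof (pos_INR n).
    assert (W * INR (length l) <= W * ((INR n + 1) * Rpower p (core_dim K M) ^ n))
      by (apply Rmult_le_compat_l; lra).
    assert (0 <= W * C0 * ((INR n + 1) * Rpower p (core_dim K M) ^ n)).
    { apply Rmult_le_pos; [nra|]. apply Rmult_le_pos; lra. }
    lra.
  - intros x Hx. destruct (HA x Hx) as (d & Hb & Hd & Hi).
    eexists. split.
    + apply in_map. apply in_prod; [apply (in_words M k d Hb)|apply (Hc _ Hi)].
    + exists d. auto.
  - intros U HU x y Hx Hy. apply in_map_iff in HU as ([w v] & <- & _).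
    destruct Hx as (d & Hd & Hd1 & Hd2), Hy as (e & He & He1 & He2). simpl in *.
    eapply Rle_trans; [apply (Hcode n x y d e); auto|].
    + intros i Hi. destruct (Nat.lt_ge_cases i k) as [L|L].
      * apply (prefix_eq k); auto. congruence.
      * replace i with (k + (i - k))%nat by lia.
        apply (prefix_eq n (tail k d) (tail k e)); [congruence|lia].
    + assert (0 < / r ^ n) by (apply Rinv_0_lt_compat, pow_lt; lra).
      apply Rmult_le_compat_r; nra.
Qed.

Lemma max_sum_ge1 M q : 1 < q <= INR M + 1 -> 1 <= INR M / (q - 1).
Proof.
  intros Hq. apply Rmult_le_reg_r with (q - 1); [lra|]. unfold Rdiv.
  rewrite Rmult_assoc, Rinv_l; lra.
Qed.

(** After a digit [M] the tail value moves by [y -> q y - M], which pushes values downwards from its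
    fixed point [M / (q - 1)]. So a bound on tails survives top digits. *)
Lemma tail_top_digit M q d i : 1 < q -> bounded M d -> ~ (d i < M)%nat ->
  dval q (tail (S i) d) <= dval q (tail i d).
Proof.
  intros Hq Hd Hi.
  pose proof (dval_tail M q d i Hq Hd) as E.
  pose proof (dval_le_max M q _ Hq (bounded_tail _ i _ Hd)) as H.
  assert (d i = M) by (specialize (Hd i); lia). rewrite H0 in E.
  apply Rmult_le_compat_l with (r := q - 1) in H; [|lra].
  replace ((q - 1) * (INR M / (q - 1))) with (INR M) in H by (field; lra). lra.
Qed.

Lemma tails_lt1_after M q d i : 1 < q -> bounded M d ->
  (forall i, (d i < M)%nat -> dval q (tail (S i) d) < 1) -> (d i < M)%nat ->
  forall j, (i < j)%nat -> dval q (tail j d) < 1.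
Proof.
  intros Hq Hd Hu Hi j Hj. induction Hj as [|j Hj IH]; [auto|].
  destruct (classic (d j < M)%nat) as [L|L]; auto.
  pose proof (tail_top_digit M q d j Hq Hd L). lra.
Qed.

Lemma reflected_tails_lt1_after M q d i : 1 < q -> bounded M d ->
  (forall i, (0 < d i)%nat -> dval q (reflect M (tail (S i) d)) < 1) -> (0 < d i)%nat ->
  forall j, (i < j)%nat -> dval q (reflect M (tail j d)) < 1.
Proof.
  intros Hq Hd Hl Hi.
  apply (tails_lt1_after M q (reflect M d) i Hq (bounded_reflect M d)).
  - intros j Hj. apply Hl. unfold reflect in Hj. lia.
  - unfold reflect. specialize (Hd i). lia.
Qed.

Lemma digit_le M q d i K : 1 < q -> bounded M d ->
  q * dval q (tail i d) - dval q (tail (S i) d) < INR K + 1 -> (d i <= K)%nat.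
Proof.
  intros Hq Hd H. pose proof (dval_tail M q d i Hq Hd) as E.
  assert (INR (d i) < INR (S K)) by (rewrite S_INR; lra).
  apply INR_lt in H0. lia.
Qed.

(** A digit equals [q] times its tail value minus the next one, hence is below [q <= K + 1]; the
    same for the reflection bounds the digit from below. *)
Lemma inner_of_tails K M q d k : (K <= M)%nat -> 1 < q <= INR K + 1 -> bounded M d ->
  (forall j, (k <= j)%nat -> dval q (tail j d) < 1) ->
  (forall j, (k <= j)%nat -> dval q (reflect M (tail j d)) < 1) ->
  inner K M q (tail k d).
Proof.
  intros HK Hq Hd Hu Hl. split.
  - intros i. set (j := (k + i)%nat). assert (Hj : (k <= j)%nat) by (unfold j; lia).
    change (tail k d i) with (d j). split.
    + assert (M - d j <= K)%nat; [|lia].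
      apply (digit_le M q (reflect M d) j); [lra|apply bounded_reflect|].
      specialize (Hl j Hj). change (reflect M (tail j d)) with (tail j (reflect M d)) in Hl.
      pose proof (dval_ge0 M q (tail (S j) (reflect M d)) (proj1 Hq)
        (bounded_tail _ _ _ (bounded_reflect M d))). nra.
    + apply (digit_le M q); [lra|auto|]. specialize (Hu j Hj).
      pose proof (dval_ge0 M q (tail (S j) d) (proj1 Hq) (bounded_tail _ _ _ Hd)). nra.
  - intros i. rewrite (dval_ext q _ (tail (k + i) d)); [apply Hu; lia|].
    intros n. unfold tail. f_equal. lia.
Qed.

(** The two endpoints come from the constant sequences. Any other sequence has a digit below [M] and
    a positive digit, and from the later of the two on all tails and reflected tails stay below
    1. *)
Lemma univoque_set_core K M q x : (1 <= K <= M)%nat -> 1 < q <= INR K + 1 -> univoque_set M q x ->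
  x = 0 \/ x = INR M / (q - 1) \/
  exists k, exists d, bounded M d /\ dval q d = x /\ inner K M q (tail k d).
Proof.
  intros HK Hq (Hx & d & Hd & Hun).
  assert (HqM : 1 < q <= INR M + 1).
  { split; [lra|]. assert (INR K <= INR M) by (apply le_INR; lia). lra. }
  destruct (tails_of_unique M q x d HqM Hd Hun) as [Hu Hl].
  apply is_expansion_dval in Hd as [Hb Hd]; [|lra].
  destruct (classic (exists i, (d i < M)%nat)) as [[i Hi]|N].
  2:{ right; left. rewrite <- Hd, <- dval_const by lra. apply dval_ext. intros n.
      specialize (Hb n). apply NNPP; intros Hne. apply N. exists n. lia. }
  destruct (classic (exists i, (0 < d i)%nat)) as [[j Hj]|N].
  2:{ left. rewrite <- Hd. transitivity (dval q (fun _ => 0%nat)).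
      - apply dval_ext. intros n. apply NNPP; intros Hne. apply N. exists n. lia.
      - rewrite dval_const by lra. simpl. field. lra. }
  right; right. exists (S (max i j)), d. split; [auto|split; [auto|]].
  apply (inner_of_tails K M q d (S (max i j))); auto; try lia; intros j' Hj'.
  - apply (tails_lt1_after M q d i); auto; [lra|lia].
  - apply (reflected_tails_lt1_after M q d j); auto; [lra|lia].
Qed.

Lemma univoque_set_small_covers K M q sigma : (1 <= K <= M)%nat -> 1 < q <= INR K + 1 ->
  core_dim K M < sigma -> small_covers sigma (univoque_set M q).
Proof.
  intros HK Hq Hs.
  destruct (core_dim_spec K M HK) as (_ & HD & _).
  apply small_covers_subset with (fun x => x = 0 \/ x = INR M / (q - 1) \/
    exists k, exists d, bounded M d /\ dval q d = x /\ inner K M q (tail k d)).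
  { intros x Hx. apply univoque_set_core; auto. }
  apply small_covers_or; [|apply small_covers_or].
  1,2: apply small_covers_subsingleton; [lra|intros; congruence].
  apply small_covers_union. intros k.
  assert (HM : 0 <= INR M / (q - 1)).
  { apply Rmult_le_pos; [apply pos_INR|left; apply Rinv_0_lt_compat; lra]. }
  apply (small_covers_coded K M k q q sigma (INR M / (q - 1)) _ (fun x d => bounded M d /\ dval q d = x));
    auto; try lra.
  - apply Rpower_lt; lra.
  - intros x (d & H1 & H2 & H3). exists d. auto.
  - intros n x y d e [Hd <-] [He <-] Hde.
    rewrite (dval_agree M q d e n) by (auto; try lra; intros; apply Hde; lia).
    unfold Rdiv at 1. rewrite Rabs_mult.
    assert (0 < / q ^ n) by (apply Rinv_0_lt_compat, pow_lt; lra).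
    rewrite (Rabs_pos_eq (/ q ^ n)) by lra. apply Rmult_le_compat_r; [lra|].
    pose proof (dval_ge0 M q _ (proj1 Hq) (bounded_tail _ n _ Hd)).
    pose proof (dval_ge0 M q _ (proj1 Hq) (bounded_tail _ n _ He)).
    pose proof (dval_le_max M q _ (proj1 Hq) (bounded_tail _ n _ Hd)).
    pose proof (dval_le_max M q _ (proj1 Hq) (bounded_tail _ n _ He)).
    apply Rabs_le. lra.
Qed.

(** Evaluate [d2] in the smaller base: the first digit being positive, the value exceeds 1 by at
    least [1 / q1 - 1 / q2]; agreeing with [d1] on [n] digits, it exceeds 1 by at most
    [(M / (r - 1)) / r ^ n]. *)
Lemma base_distance M r B q1 q2 d1 d2 n :
  1 < r <= q1 -> q1 <= q2 <= B -> bounded M d1 -> bounded M d2 ->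
  dval q1 d1 = 1 -> dval q2 d2 = 1 -> (1 <= d2 0)%nat ->
  (forall i, (i < n)%nat -> d1 i = d2 i) ->
  q2 - q1 <= B * B * (INR M / (r - 1)) / r ^ n.
Proof.
  intros Hr Hq Hd1 Hd2 H1 H2 H0 Hag.
  assert (Hd0 : 1 <= INR (d2 0%nat)) by (apply (le_INR 1); auto).
  assert (Ha : dval q1 d2 - dval q2 d2 >= / q1 - / q2).
  { rewrite (dval_cons M q1 d2), (dval_cons M q2 d2) by (auto; lra).
    pose proof (dval_decreasing M q1 q2 (tail 1 d2) ltac:(lra) (bounded_tail _ _ _ Hd2)).
    pose proof (dval_ge0 M q2 (tail 1 d2) ltac:(lra) (bounded_tail _ _ _ Hd2)).
    assert (0 < / q2) by (apply Rinv_0_lt_compat; lra).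
    assert (/ q2 <= / q1) by (apply Rinv_le_contravar; lra). unfold Rdiv. nra. }
  assert (HM : 0 <= INR M) by apply pos_INR.
  assert (Hb : dval q1 d2 <= 1 + INR M / (r - 1) / r ^ n).
  { pose proof (dval_agree M q1 d2 d1 n ltac:(lra) Hd2 Hd1 ltac:(intros; symmetry; auto)) as E.
    pose proof (dval_ge0 M q1 (tail n d1) ltac:(lra) (bounded_tail _ _ _ Hd1)).
    pose proof (dval_le_max M q1 (tail n d2) ltac:(lra) (bounded_tail _ _ _ Hd2)).
    assert (0 < / q1 ^ n) by (apply Rinv_0_lt_compat, pow_lt; lra).
    assert (/ q1 ^ n <= / r ^ n).
    { apply Rinv_le_contravar; [apply pow_lt; lra|]. apply pow_incr; lra. }
    assert (INR M / (q1 - 1) <= INR M / (r - 1)).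
    { apply Rmult_le_compat_l; auto. apply Rinv_le_contravar; lra. }
    assert (0 <= INR M / (q1 - 1)).
    { apply Rmult_le_pos; auto. left; apply Rinv_0_lt_compat; lra. }
    unfold Rdiv at 1 in E. unfold Rdiv at 1.
    assert ((dval q1 (tail n d2) - dval q1 (tail n d1)) * / q1 ^ n <= INR M / (r - 1) * / r ^ n).
    { apply Rle_trans with (INR M / (r - 1) * / q1 ^ n); [apply Rmult_le_compat_r; lra|].
      apply Rmult_le_compat_l; lra. }
    lra. }
  set (E := INR M / (r - 1) / r ^ n) in *.
  assert (Hc : / q1 - / q2 <= E) by lra.
  replace (q2 - q1) with (q1 * q2 * (/ q1 - / q2)) by (field; lra).
  replace (B * B * (INR M / (r - 1)) / r ^ n) with (B * B * E) by (unfold E, Rdiv; ring).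
  assert (0 <= / q1 - / q2) by (assert (/ q2 <= / q1) by (apply Rinv_le_contravar; lra); lra).
  apply Rle_trans with (B * B * (/ q1 - / q2)).
  - apply Rmult_le_compat_r; auto. nra.
  - apply Rmult_le_compat_l; auto. nra.
Qed.

(** In base [q] every tail of the expansion of 1 has value at most 1, starting with 1 itself. In the
    larger base [p] the recursion gives [p] times the tail value at most [q], so the bound becomes
    strict. *)
Lemma univoque_base_core K M q p : (1 <= K <= M)%nat -> 1 < q < p -> p <= INR K + 1 ->
  univoque_bases M q ->
  exists d, bounded M d /\ dval q d = 1 /\ (1 <= d 0)%nat /\ inner K M p (tail 1 d).
Proof.
  intros HK Hq Hp (HqM & d & Hd & Hun).
  destruct (tails_of_unique M q 1 d HqM Hd Hun) as [Hu Hl].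
  apply is_expansion_dval in Hd as [Hb Hd]; [|lra].
  pose proof (max_sum_ge1 M q HqM) as Hmax.
  (* If the first digit were 0, the remaining tail would have value [q > 1], although it must be
     below 1. *)
  assert (H0 : (1 <= d 0)%nat).
  { apply Nat.nlt_ge. intros L. pose proof (dval_tail M q d 0 (proj1 HqM) Hb) as E.
    change (tail 0 d) with d in E. assert (d 0%nat < M)%nat by lia.
    specialize (Hu 0%nat H). replace (d 0%nat) with 0%nat in E by lia. rewrite Hd in E. change (INR 0) with 0 in E. lra. }
  assert (Hle : forall j, dval q (tail j d) <= 1).
  { induction j as [|j IH]; [change (tail 0 d) with d; lra|].
    destruct (classic (d j < M)%nat) as [L|L]; [left; auto|].
    pose proof (tail_top_digit M q d j (proj1 HqM) Hb L). lra. }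
  assert (Hlow : forall j, (1 <= j)%nat -> dval q (reflect M (tail j d)) < 1).
  { intros j Hj. apply (reflected_tails_lt1_after M q d 0); auto; lra. }
  assert (Hpos : forall j, (1 <= j)%nat -> 0 < dval q (tail j d)).
  { intros j Hj. specialize (Hlow j Hj). rewrite dval_reflect in Hlow by (auto using bounded_tail; lra). lra. }
  exists d. repeat split; auto.
  - change (tail 1 d i) with (d (S i)).
    assert (M - d (S i) <= K)%nat; [|lia].
    apply (digit_le M q (reflect M d) (S i)); [lra|apply bounded_reflect|].
    assert (G := Hlow (S i) ltac:(lia)). change (reflect M (tail (S i) d)) with (tail (S i) (reflect M d)) in G.
    pose proof (dval_ge0 M q (tail (S (S i)) (reflect M d)) (proj1 Hq)
      (bounded_tail _ _ _ (bounded_reflect M d))). nra.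
  - change (tail 1 d i) with (d (S i)). apply (digit_le M q); [lra|auto|].
    specialize (Hle (S i)). specialize (Hpos (S (S i)) ltac:(lia)). nra.
  - intros i. change (tail i (tail 1 d)) with (tail (S i) d).
    set (e := tail (S i) d). assert (He : bounded M e) by (apply bounded_tail; auto).
    specialize (Hle (S i)). specialize (Hpos (S i) ltac:(lia)). fold e in Hle, Hpos.
    pose proof (dval_decreasing M q p (tail 1 e) ltac:(lra) (bounded_tail _ _ _ He)) as H1.
    pose proof (dval_tail M q e 0 ltac:(lra) He) as E1. pose proof (dval_tail M p e 0 ltac:(lra) He) as E2.
    change (tail 0 e) with e in E1, E2.
    apply Rmult_lt_reg_l with p; nra.
Qed.

Lemma geometric_bracket B theta q : 1 < q < B -> 0 < theta < 1 ->
  exists k : nat, Rpower B (theta ^ S k) <= q < Rpower B (theta ^ k).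
Proof.
  intros Hq Ht.
  assert (HlB : 0 < ln B) by (rewrite <- ln_1; apply ln_increasing; lra).
  assert (Hlq : 0 < ln q) by (rewrite <- ln_1; apply ln_increasing; lra).
  assert (Hn : exists n, Rpower B (theta ^ n) <= q).
  { destruct (pow_lt_1_zero theta) with (y := ln q / ln B) as [n Hn].
    - rewrite Rabs_pos_eq; lra.
    - apply Rdiv_lt_0_compat; auto.
    - exists n. specialize (Hn n (Nat.le_refl n)).
      rewrite Rabs_pos_eq in Hn by (apply pow_le; lra).
      rewrite <- (exp_ln q) by lra. left. apply exp_increasing.
      apply Rmult_lt_compat_r with (r := ln B) in Hn; auto.
      unfold Rdiv in Hn. rewrite Rmult_assoc, Rinv_l, Rmult_1_r in Hn; lra. }
  destruct Hn as [n Hn]. induction n as [|n IH].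
  - rewrite pow_O, Rpower_1 in Hn; lra.
  - destruct (Rle_lt_dec (Rpower B (theta ^ n)) q); auto. exists n; auto.
Qed.

(** Below [B] the bases split into countably many intervals [[p ^ theta, p)]. On each, words are
    counted in base [p] and cylinders shrink at least at the rate [p ^ theta], so
    [D < theta * sigma] suffices; the chosen [theta] makes [theta * sigma] the mean of [D] and
    [sigma]. *)
Lemma univoque_bases_small_covers K M sigma : (1 <= K <= M)%nat -> core_dim K M < sigma ->
  small_covers sigma (fun q => q <= INR K + 1 /\ univoque_bases M q).
Proof.
  intros HK Hs.
  destruct (core_dim_spec K M HK) as (_ & HD & _). set (D := core_dim K M) in *.
  set (B := INR K + 1). assert (HB : 1 < B) by (unfold B; pose proof (lt_0_INR K ltac:(lia)); lra).
  set (theta := (D + sigma) / (2 * sigma)).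
  assert (Ht : 0 < theta < 1).
  { unfold theta. split; [apply Rdiv_lt_0_compat; lra|].
    apply Rmult_lt_reg_r with (2 * sigma); [lra|]. unfold Rdiv. rewrite Rmult_assoc, Rinv_l; lra. }
  assert (HDt : D < theta * sigma) by (unfold theta; replace ((D + sigma) / (2 * sigma) * sigma) with ((D + sigma) / 2) by (field; lra); lra).
  (* The half-open intervals never reach [B], which is covered as a single point. *)
  apply small_covers_subset with (fun q => q = B \/
    exists k : nat, Rpower B (theta ^ S k) <= q < Rpower B (theta ^ k) /\ univoque_bases M q).
  { intros q [HqB Hq]. destruct (Req_dec q B) as [E|E]; [left; auto|right].
    destruct (geometric_bracket B theta q) as [k Hk]; auto; [|exists k; auto].
    destruct Hq as [[Hq1 _] _]. fold B in HqB. lra. }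
  apply small_covers_or; [apply small_covers_subsingleton; [lra|congruence]|].
  apply small_covers_union. intros k.
  set (p := Rpower B (theta ^ k)). set (r := Rpower B (theta ^ S k)).
  assert (Htk : 0 < theta ^ k) by (apply pow_lt; lra).
  assert (HtS : 0 < theta ^ S k) by (apply pow_lt; lra).
  assert (Htk1 : theta ^ k <= 1) by (rewrite <- (pow1 k); apply pow_incr; lra).
  assert (Hr : 1 < r) by (unfold r; rewrite <- (Rpower_O B) by lra; apply Rpower_lt; auto).
  assert (HpB : p <= B).
  { unfold p. rewrite <- (Rpower_1 B) at 2 by lra. apply Rle_Rpower; lra. }
  assert (Hrp : r < p).
  { apply Rpower_lt; auto. simpl. nra. }
  apply (small_covers_coded K M 1 p r sigma (B * B * (INR M / (r - 1))) _
    (fun q d => r <= q < p /\ bounded M d /\ dval q d = 1 /\ (1 <= d 0)%nat)); auto; try lra.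
  - fold B. lra.
  - assert (0 <= INR M / (r - 1)) by (apply Rmult_le_pos; [apply pos_INR|left; apply Rinv_0_lt_compat; lra]).
    apply Rmult_le_pos; nra.
  - unfold p, r. rewrite !Rpower_mult. apply Rpower_lt; auto. fold D. simpl. nra.
  - intros q [Hq HU]. fold p r in Hq.
    destruct (univoque_base_core K M q p) as (d & H1 & H2 & H3 & H4); auto; try lra.
    exists d. auto 10.
  - intros n x y d e (Hx & Hd & Hxd & Hd0) (Hy & He & Hye & He0) Hde.
    destruct (Rle_lt_dec x y) as [L|L].
    + rewrite Rabs_left1 by lra.
      pose proof (base_distance M r B x y d e n) as G.
      assert (y - x <= B * B * (INR M / (r - 1)) / r ^ n); [|lra].
      apply G; auto; try lra.
    + rewrite Rabs_pos_eq by lra.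
      apply (base_distance M r B y x e d n); auto; try lra. intros i Hi. symmetry. apply Hde. lia.
Qed.

(** * Univoque points and bases with prescribed blocks *)

(* Blocks [M-K, K, w, ..., w] with [m] free digits each: every window of length
   [m + 2] contains both extreme digits. *)
Definition block (K M m : nat) (w : nat -> nat) (i : nat) : nat :=
  let o := (i mod (m + 2))%nat in
  if (o =? 0)%nat then (M - K)%nat
  else if (o =? 1)%nat then K
  else (M - K + w (i / (m + 2) * m + (o - 2)))%nat.

(** The initial run of [K] is exactly one window long: only the window at position 0 misses the
    digit [M - K], so only the full sequence can reach the value 1. *)
Definition lead (K M m : nat) (w : nat -> nat) (i : nat) : nat :=
  if (i <? m + 2)%nat then K else block K M m w (i - (m + 2)).

Lemma block_at K M m w a o : (o < m + 2)%nat ->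
  block K M m w ((m + 2) * a + o) =
  if (o =? 0)%nat then (M - K)%nat else if (o =? 1)%nat then K else (M - K + w (a * m + (o - 2)))%nat.
Proof.
  intros Ho. unfold block.
  rewrite <- (Nat.mod_unique ((m + 2) * a + o) (m + 2) a o),
    <- (Nat.div_unique ((m + 2) * a + o) (m + 2) a o) by auto. reflexivity.
Qed.

Lemma block_0 K M m w : block K M m w 0 = (M - K)%nat.
Proof. pose proof (block_at K M m w 0 0 ltac:(lia)) as E. rewrite Nat.mul_0_r in E. exact E. Qed.

Lemma block_1 K M m w : block K M m w 1 = K.
Proof.
  unfold block. rewrite Nat.mod_small by lia. reflexivity.
Qed.

Lemma block_window m i c : (c < m + 2)%nat ->
  exists j a, (j < m + 2)%nat /\ (i + j = (m + 2) * a + c)%nat.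
Proof.
  intros Hc. pose proof (Nat.div_mod_eq i (m + 2)) as E.
  pose proof (Nat.mod_upper_bound i (m + 2) ltac:(lia)) as Hb.
  destruct (Nat.le_gt_cases (i mod (m + 2)) c) as [L|L].
  - exists (c - i mod (m + 2))%nat, (i / (m + 2))%nat. lia.
  - exists (m + 2 - i mod (m + 2) + c)%nat, (S (i / (m + 2))). lia.
Qed.

(** The value is [K / (q - 1)] minus that of the reflection, whose [j]-th digit is at least 1. *)
Lemma dval_le_of_smaller_digit K q d j n : 1 < q -> bounded K d -> (j < n)%nat -> (d j < K)%nat ->
  dval q d <= INR K / (q - 1) - / q ^ n.
Proof.
  intros Hq Hd Hj Hdj.
  pose proof (dval_ge_term K q (reflect K d) j Hq (bounded_reflect K d)) as H.
  rewrite dval_reflect in H by auto.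
  assert (H1 : 1 <= INR (reflect K d j)) by (apply (le_INR 1); unfold reflect; lia).
  assert (H2 : / q ^ n <= / q ^ S j).
  { apply Rinv_le_contravar; [apply pow_lt; lra|]. apply Rle_pow; [lra|lia]. }
  assert (0 < / q ^ S j) by (apply Rinv_0_lt_compat, pow_lt; lra).
  unfold Rdiv at 1 in H. nra.
Qed.

Lemma first_difference_gap M q d e h : 1 < q -> bounded M d -> bounded M e ->
  (forall i, (i < h)%nat -> d i = e i) -> (d h < e h)%nat ->
  (1 - dval q (tail (S h) d)) / q ^ S h <= dval q e - dval q d.
Proof.
  intros Hq Hd He Hag Hh.
  rewrite (dval_agree M q e d h) by (auto; intros; symmetry; auto).
  pose proof (dval_tail M q d h Hq Hd). pose proof (dval_tail M q e h Hq He).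
  pose proof (dval_ge0 M q _ Hq (bounded_tail _ (S h) _ He)).
  apply le_INR in Hh. rewrite S_INR in Hh.
  assert (0 < q ^ h) by (apply pow_lt; lra).
  replace ((dval q (tail h e) - dval q (tail h d)) / q ^ h)
    with (q * (dval q (tail h e) - dval q (tail h d)) / q ^ S h) by (simpl; field; lra).
  apply Rmult_le_compat_r; [|lra]. left. apply Rinv_0_lt_compat, pow_lt; lra.
Qed.

Lemma lead_shift K M m w i : lead K M m w (m + 2 + i) = block K M m w i.
Proof.
  unfold lead. replace (m + 2 + i <? m + 2)%nat with false by (symmetry; apply Nat.ltb_ge; lia).
  f_equal. lia.
Qed.

Lemma lead_start K M m w i : (i < m + 2)%nat -> lead K M m w i = K.
Proof. intros H. unfold lead. apply Nat.ltb_lt in H. now rewrite H. Qed.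

Section Construction.
Variables (K M m : nat).
Hypotheses (HK : (1 <= K <= M)%nat) (HMK : (M < 2 * K)%nat) (Hm : (2 <= m)%nat).

Let B := INR K + 1.
Let n := (m + 2)%nat.
Let valid (w : nat -> nat) : Prop := forall i, (w i < core_size K M)%nat.

Let HB : 2 <= B.
Proof. unfold B. pose proof (le_INR 1 K ltac:(lia)). simpl in H. lra. Qed.

Lemma block_digits w i : valid w -> (M - K <= block K M m w i <= K)%nat.
Proof.
  intros Hw. unfold block. specialize (Hw (i / (m + 2) * m + (i mod (m + 2) - 2))%nat).
  unfold core_size in Hw. destruct Nat.eqb; [lia|]. destruct Nat.eqb; lia.
Qed.

Lemma lead_digits w i : valid w -> (M - K <= lead K M m w i <= K)%nat.
Proof. intros Hw. unfold lead. destruct Nat.ltb; [lia|]. apply block_digits; auto. Qed.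

Lemma block_low w i : exists j, (j < n)%nat /\ block K M m w (i + j) = (M - K)%nat.
Proof.
  destruct (block_window m i 0) as (j & a & Hj & E); [lia|].
  exists j. split; auto. rewrite E, block_at by lia. reflexivity.
Qed.

Lemma block_high w i : exists j, (j < n)%nat /\ block K M m w (i + j) = K.
Proof.
  destruct (block_window m i 1) as (j & a & Hj & E); [lia|].
  exists j. split; auto. rewrite E, block_at by lia. reflexivity.
Qed.

(** A window starting at a position from 1 to [n] contains position [n], where the first block opens
    with [M - K]; later windows lie inside the blocks. *)
Lemma lead_low w i : (1 <= i)%nat -> exists j, (j < n)%nat /\ lead K M m w (i + j) = (M - K)%nat.
Proof.
  intros Hi. destruct (Nat.le_gt_cases i n) as [L|L].
  - exists (n - i)%nat. split; [unfold n; lia|].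
    replace (i + (n - i))%nat with (n + 0)%nat by lia. rewrite lead_shift.
    apply block_0.
  - destruct (block_low w (i - n)) as (j & Hj & E). exists j. split; auto.
    replace (i + j)%nat with (n + (i - n + j))%nat by lia. rewrite lead_shift. auto.
Qed.

Lemma lead_high w i : exists j, (j < n)%nat /\ lead K M m w (i + j) = K.
Proof.
  destruct (Nat.lt_ge_cases i n) as [L|L].
  - exists 0%nat. split; [unfold n; lia|]. rewrite Nat.add_0_r. apply lead_start; auto.
  - destruct (block_high w (i - n)) as (j & Hj & E). exists j. split; auto.
    replace (i + j)%nat with (n + (i - n + j))%nat by lia. rewrite lead_shift. auto.
Qed.

(** Free digit [j] sits in block [j / m], so it is preceded by two fixed digits for each of the
    [j / m + 1] blocks opened so far. *)
Lemma block_first_difference w w' j : (forall i, (i < j)%nat -> w i = w' i) -> w j <> w' j ->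
  exists h, (forall i, (i < h)%nat -> block K M m w i = block K M m w' i) /\
    block K M m w h <> block K M m w' h /\ (h = j + 2 * (j / m) + 2)%nat.
Proof.
  intros Hag Hj. pose proof (Nat.div_mod_eq j m) as E.
  pose proof (Nat.mod_upper_bound j m ltac:(lia)) as Hb.
  set (a := (j / m)%nat) in *. set (o := (j mod m)%nat) in *.
  exists ((m + 2) * a + (o + 2))%nat. split; [|split].
  - intros i Hi. pose proof (Nat.div_mod_eq i (m + 2)) as E'.
    pose proof (Nat.mod_upper_bound i (m + 2) ltac:(lia)) as Hb'.
    set (a' := (i / (m + 2))%nat) in *. set (o' := (i mod (m + 2))%nat) in *.
    rewrite E', !block_at by auto.
    destruct (Nat.eqb_spec o' 0); auto. destruct (Nat.eqb_spec o' 1); auto.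
    f_equal. apply Hag. destruct (Nat.lt_trichotomy a' a) as [L|[L|L]]; [nia|subst a'; nia|nia].
  - rewrite !block_at by lia.
    destruct (Nat.eqb_spec (o + 2) 0); [lia|]. destruct (Nat.eqb_spec (o + 2) 1); [lia|].
    replace (a * m + (o + 2 - 2))%nat with j by lia. lia.
  - lia.
Qed.

(** The contraction per free digit: a block spends [m + 2] places on [m] free digits. *)
Let rate := Rpower B (1 + 2 / INR m).

Lemma rate_bound j h : (h = j + 2 * (j / m) + 2)%nat -> / B ^ 3 / rate ^ j <= / B ^ S h.
Proof.
  intros ->. replace (S (j + 2 * (j / m) + 2)) with (3 + (j + 2 * (j / m)))%nat by lia.
  rewrite pow_add, Rinv_mult. apply Rmult_le_compat_l.
  { left. apply Rinv_0_lt_compat, pow_lt; lra. }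
  apply Rinv_le_contravar; [apply pow_lt; lra|].
  unfold rate. rewrite <- Rpower_pow_comm by lra. rewrite <- !Rpower_pow by lra.
  rewrite Rpower_mult. apply Rle_Rpower; [lra|].
  assert (Hm' : 0 < INR m) by (apply lt_0_INR; lia).
  rewrite plus_INR, mult_INR. simpl (INR 2).
  assert (INR (j / m) <= INR j / INR m).
  { apply Rmult_le_reg_r with (INR m); auto. unfold Rdiv. rewrite Rmult_assoc, Rinv_l, Rmult_1_r by lra.
    rewrite <- mult_INR. apply le_INR. rewrite Nat.mul_comm. apply Nat.Div0.mul_div_le. }
  unfold Rdiv in *. lra.
Qed.

(** Every window contains a digit [M - K], which is below [K], and a digit [K], whose reflection is
    [M - K]. In base [B] the bound is [1 - / B ^ n], giving both uniqueness and separation. *)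
Lemma block_tails w i q : 1 < q -> valid w ->
  dval q (tail i (block K M m w)) <= INR K / (q - 1) - / q ^ n /\
  dval q (reflect M (tail i (block K M m w))) <= INR K / (q - 1) - / q ^ n.
Proof.
  intros Hq Hw. split.
  - destruct (block_low w i) as (j & Hj & E).
    apply (dval_le_of_smaller_digit K q _ j); auto; [|unfold tail; lia].
    intros k. apply block_digits; auto.
  - destruct (block_high w i) as (j & Hj & E).
    apply (dval_le_of_smaller_digit K q _ j); auto; [|unfold reflect, tail; lia].
    intros k. unfold reflect, tail. pose proof (block_digits w (i + k) Hw). lia.
Qed.

Lemma block_in_univoque_set w : valid w -> univoque_set M B (dval B (block K M m w)).
Proof.
  intros Hw.
  assert (Hb : bounded M (block K M m w)) by (intros i; pose proof (block_digits w i Hw); lia).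
  assert (HK1 : INR K / (B - 1) = 1) by (unfold B; field; pose proof HB; unfold B in *; lra).
  assert (Hp : 0 < / B ^ n) by (apply Rinv_0_lt_compat, pow_lt; pose proof HB; lra).
  assert (HB1 : 1 < B) by (pose proof HB; lra).
  split; [split; [apply (dval_ge0 M)|apply dval_le_max]; auto|].
  apply unique_of_tails; auto; intros i _; destruct (block_tails w (S i) B HB1 Hw); lra.
Qed.

Lemma block_separated w w' j : valid w -> valid w' -> (forall i, (i < j)%nat -> w i = w' i) -> w j <> w' j ->
  / B ^ n * / B ^ 3 / rate ^ j <= Rabs (dval B (block K M m w) - dval B (block K M m w')).
Proof.
  intros Hw Hw' Hag Hj. destruct (block_first_difference w w' j Hag Hj) as (h & H1 & H2 & H3).
  pose proof (rate_bound j h H3) as Hr.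
  assert (HB1 : 1 < B) by (pose proof HB; lra).
  assert (HK1 : INR K / (B - 1) = 1) by (unfold B; field; unfold B in *; lra).
  assert (Hgap : forall v v', valid v -> valid v' ->
    (forall i, (i < h)%nat -> block K M m v i = block K M m v' i) ->
    (block K M m v h < block K M m v' h)%nat ->
    / B ^ n * / B ^ 3 / rate ^ j <= dval B (block K M m v') - dval B (block K M m v)).
  { intros v v' Hv Hv' Hag' Hh.
    pose proof (first_difference_gap M B (block K M m v) (block K M m v') h HB1) as G.
    assert (Hb : forall u, valid u -> bounded M (block K M m u))
      by (intros u Hu i; pose proof (block_digits u i Hu); lia).
    specialize (G (Hb v Hv) (Hb v' Hv') Hag' Hh).
    destruct (block_tails v (S h) B HB1 Hv) as [T _].
    assert (0 < / B ^ n) by (apply Rinv_0_lt_compat, pow_lt; lra).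
    assert (0 < / B ^ S h) by (apply Rinv_0_lt_compat, pow_lt; lra).
    eapply Rle_trans; [|exact G]. unfold Rdiv. rewrite Rmult_assoc.
    apply Rle_trans with (/ B ^ n * / B ^ S h); [apply Rmult_le_compat_l; lra|].
    apply Rmult_le_compat_r; lra. }
  destruct (Nat.lt_gt_cases (block K M m w h) (block K M m w' h)) as [[L|L] _]; auto.
  - rewrite Rabs_minus_sym. eapply Rle_trans; [apply (Hgap w w'); auto|apply Rle_abs].
  - eapply Rle_trans; [apply (Hgap w' w); auto; intros; symmetry; auto|apply Rle_abs].
Qed.

(** * Bases in which 1 has a prescribed expansion *)

Lemma lead_bounded w : valid w -> bounded K (lead K M m w).
Proof. intros Hw i. apply lead_digits; auto. Qed.

Lemma lead_two_terms w q : 1 < q -> valid w ->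
  INR K / q + INR K / q ^ 2 <= dval q (lead K M m w).
Proof.
  intros Hq Hw. pose proof (lead_bounded w Hw) as Hb.
  rewrite (dval_cons K) by auto.
  pose proof (dval_ge_term K q (tail 1 (lead K M m w)) 0 Hq (bounded_tail _ _ _ Hb)) as H.
  unfold tail in H at 1. rewrite (lead_start K M m w (1 + 0)) in H by (unfold n; lia).
  rewrite (lead_start K M m w 0) by (unfold n; lia). rewrite pow_1 in H.
  replace (INR K / q + INR K / q ^ 2) with ((INR K + INR K / q) / q) by (field; lra).
  apply Rmult_le_compat_r; [left; apply Rinv_0_lt_compat; lra|lra].
Qed.

(** Intermediate values on [[8/5, B]]: at 8/5 the first two digits already contribute
    [65 K / 64 > 1], while at [B] the sequence loses against the constant [K], whose value is 1. *)
Lemma lead_base_exists w : valid w -> exists q, 3 / 2 <= q <= B /\ dval q (lead K M m w) = 1.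
Proof.
  intros Hw. pose proof (lead_bounded w Hw) as Hb.
  assert (HK1 : 1 <= INR K) by (apply (le_INR 1); lia).
  set (f := fun q => 1 - dval q (lead K M m w)).
  destruct (Ranalysis5.IVT_interv f (8 / 5) B) as (q & Hq & Hf).
  - intros a Ha.
    (* The radius 1/10 keeps the neighbours of a point of [[8/5, B]] at or above 3/2, where
       [dval_lipschitz] applies. *)
    intros eps Heps. exists (Rmin (1 / 10) (eps / (9 * INR K + 1))).
    assert (0 < eps / (9 * INR K + 1)) by (apply Rdiv_lt_0_compat; lra).
    split; [apply Rmin_glb_lt; lra|].
    intros x [_ Hx]. simpl in Hx. unfold R_dist in Hx.
    pose proof (Rmin_l (1 / 10) (eps / (9 * INR K + 1))). pose proof (Rmin_r (1 / 10) (eps / (9 * INR K + 1))).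
    assert (Hxa : Rabs (x - a) < 1 / 10) by lra. apply Rabs_def2 in Hxa.
    simpl. unfold R_dist, f.
    replace (1 - dval x (lead K M m w) - (1 - dval a (lead K M m w)))
      with (- (dval x (lead K M m w) - dval a (lead K M m w))) by ring.
    rewrite Rabs_Ropp.
    eapply Rle_lt_trans; [apply (dval_lipschitz K); auto; lra|].
    pose proof (Rabs_pos (x - a)).
    apply Rle_lt_trans with ((9 * INR K + 1) * Rabs (x - a)); [lra|].
    assert (E : eps = (9 * INR K + 1) * (eps / (9 * INR K + 1))) by (field; lra).
    rewrite E. apply Rmult_lt_compat_l; lra.
  - pose proof HB; lra.
  - unfold f. pose proof (lead_two_terms w (8 / 5) ltac:(lra) Hw) as H.
    replace (INR K / (8 / 5) + INR K / (8 / 5) ^ 2) with (INR K * (65 / 64)) in H by field. lra.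
  - unfold f. assert (HB1 : 1 < B) by (pose proof HB; lra).
    assert (HKB : INR K / (B - 1) = 1) by (unfold B; field; unfold B in *; lra).
    pose proof (dval_le_of_smaller_digit K B (lead K M m w) n (S n) HB1 Hb) as H.
    assert (E : lead K M m w n = (M - K)%nat).
    { replace n with (n + 0)%nat by lia. rewrite lead_shift.
      apply block_0. }
    specialize (H ltac:(lia) ltac:(lia)).
    assert (0 < / B ^ S n) by (apply Rinv_0_lt_compat, pow_lt; lra). lra.
  - exists q. unfold f in Hf. lra.
Qed.

(** A gap below 1 uniform in [w] and [q]: [/ B ^ n] bounds from below the unit of loss [/ q ^ n],
    and [/ (2 * B ^ 3)] the fraction of it that remains. *)
Let margin := / (2 * B ^ 3 * B ^ n).

Let margin_pos : 0 < margin.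
Proof.
  assert (HB1 : 1 < B) by (pose proof HB; lra).
  apply Rinv_0_lt_compat. repeat apply Rmult_lt_0_compat; try apply pow_lt; lra.
Qed.

(* [K / (q - 1)] exceeds [1] by [(K / (q - 1) - dval q (block w)) / q ^ n], which is
   smaller than the loss [1 / q ^ n] caused by one digit below [K] among the first [n]. *)
Lemma value_below_one w q d j : valid w -> 3 / 2 <= q <= B -> dval q (lead K M m w) = 1 ->
  bounded K d -> (j < n)%nat -> (d j < K)%nat -> dval q d <= 1 - margin.
Proof.
  intros Hw Hq H1 Hd Hj Hdj.
  assert (Hq1 : 1 < q) by lra.
  assert (HK1 : 1 <= INR K) by (apply (le_INR 1); lia).
  pose proof (lead_bounded w Hw) as Hb.
  set (b := dval q (block K M m w)).
  assert (E1 : INR K / (q - 1) - 1 = (INR K / (q - 1) - b) / q ^ n).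
  { pose proof (dval_agree K q (fun _ => K) (lead K M m w) n Hq1 ltac:(intros ?; auto) Hb) as E.
    rewrite H1 in E. change (tail n (fun _ => K)) with (fun _ : nat => K) in E.
    rewrite dval_const in E by auto. rewrite E by (intros; symmetry; apply lead_start; auto).
    f_equal. f_equal. unfold b. apply dval_ext. intros i. apply lead_shift. }
  assert (Hb2 : / q ^ 2 <= b).
  { assert (Hbb : bounded K (block K M m w)) by (intros i; apply block_digits; auto).
    pose proof (dval_ge_term K q (block K M m w) 1 Hq1 Hbb) as H.
    rewrite block_1 in H.
    assert (0 < / q ^ 2) by (apply Rinv_0_lt_compat, pow_lt; lra).
    fold b in H. unfold Rdiv in H. nra. }
  pose proof (dval_le_of_smaller_digit K q d j n Hq1 Hd Hj Hdj) as Hle.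
  set (u := / q ^ n) in *.
  assert (Hu3 : u <= / q ^ 3).
  { apply Rinv_le_contravar; [apply pow_lt; lra|]. apply Rle_pow; [lra|unfold n; lia]. }
  assert (Hu0 : 0 < u) by (apply Rinv_0_lt_compat, pow_lt; lra).
  assert (HuB : / B ^ n <= u).
  { apply Rinv_le_contravar; [apply pow_lt; lra|]. apply pow_incr; lra. }
  (* The factor 2 comes from [q - 1 >= 1 / 2]. *)
  assert (H23 : / q ^ 2 - / q ^ 3 >= / (2 * B ^ 3)).
  { replace (/ q ^ 2 - / q ^ 3) with ((q - 1) * / q ^ 3) by (field; lra).
    assert (/ B ^ 3 <= / q ^ 3) by (apply Rinv_le_contravar; [apply pow_lt; lra|apply pow_incr; lra]).
    assert (0 < / B ^ 3) by (apply Rinv_0_lt_compat, pow_lt; lra).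
    rewrite Rinv_mult. nra. }
  set (R0 := INR K / (q - 1) - b) in *.
  assert (E2 : INR K / (q - 1) - 1 = R0 * u) by (exact E1).
  assert (E3 : R0 * (1 - u) = 1 - b) by (unfold R0 in *; lra).
  assert (Hc : 0 < / (2 * B ^ 3)) by (apply Rinv_0_lt_compat, Rmult_lt_0_compat; [lra|apply pow_lt; lra]).
  assert (Hu1 : u < 1).
  { apply Rle_lt_trans with (1 := Hu3). rewrite <- Rinv_1. apply Rinv_lt_contravar; [rewrite Rmult_1_l; apply pow_lt; lra|].
    simpl; nra. }
  (* Here [(1 - R0) (1 - u) = b - u], where [b >= / q ^ 2] from the digit [K] in second place of the
     blocks and [u <= / q ^ 3] because [n >= 3]. *)
  assert (HR : / (2 * B ^ 3) <= 1 - R0).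
  { assert ((1 - R0) * (1 - u) = b - u) by lra.
    assert (/ (2 * B ^ 3) <= b - u) by lra.
    apply Rnot_lt_le. intros L. nra. }
  assert (Hmg : margin = / (2 * B ^ 3) * / B ^ n) by (unfold margin; apply Rinv_mult).
  rewrite Hmg.
  assert (0 < / B ^ n) by (apply Rinv_0_lt_compat, pow_lt; lra).
  nra.
Qed.

Lemma lead_tails w q i : valid w -> 3 / 2 <= q <= B -> dval q (lead K M m w) = 1 -> (1 <= i)%nat ->
  dval q (tail i (lead K M m w)) <= 1 - margin /\
  dval q (reflect M (tail i (lead K M m w))) <= 1 - margin.
Proof.
  intros Hw Hq H1 Hi. split.
  - destruct (lead_low w i Hi) as (j & Hj & E).
    apply (value_below_one w q _ j); auto; [|unfold tail; lia].
    intros k. apply lead_digits; auto.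
  - destruct (lead_high w i) as (j & Hj & E).
    apply (value_below_one w q _ j); auto; [|unfold reflect, tail; lia].
    intros k. unfold reflect, tail. pose proof (lead_digits w (i + k) Hw). lia.
Qed.

Lemma lead_unique w q : valid w -> 3 / 2 <= q <= B -> dval q (lead K M m w) = 1 ->
  unique_expansion M q 1.
Proof.
  intros Hw Hq H1. rewrite <- H1. apply unique_of_tails; [lra| | |].
  - intros i. pose proof (lead_digits w i Hw). lia.
  - intros i _. destruct (lead_tails w q (S i) Hw Hq H1 ltac:(lia)). lra.
  - intros i _. destruct (lead_tails w q (S i) Hw Hq H1 ltac:(lia)). lra.
Qed.

(** In the base of the smaller sequence the larger one exceeds 1 by the first-difference gap, while
    in its own base its value is 1. The Lipschitz constant [9 K] turns this gap into a distance
    between the bases. *)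
Lemma lead_separated w w' j q q' : valid w -> valid w' ->
  3 / 2 <= q <= B -> dval q (lead K M m w) = 1 -> 3 / 2 <= q' <= B -> dval q' (lead K M m w') = 1 ->
  (forall i, (i < j)%nat -> w i = w' i) -> w j <> w' j ->
  margin * / B ^ n * / B ^ 3 * / (9 * INR K) / rate ^ j <= Rabs (q - q').
Proof.
  intros Hw Hw' Hq H1 Hq' H1' Hag Hj.
  destruct (block_first_difference w w' j Hag Hj) as (h & Hh1 & Hh2 & Hh3).
  pose proof (rate_bound j h Hh3) as Hr.
  assert (HK1 : 1 <= INR K) by (apply (le_INR 1); lia).
  assert (Hlag : forall v v', (forall i, (i < h)%nat -> block K M m v i = block K M m v' i) ->
    forall i, (i < n + h)%nat -> lead K M m v i = lead K M m v' i).
  { intros v v' H i Hi. destruct (Nat.lt_ge_cases i n) as [L|L].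
    - rewrite !lead_start; auto.
    - replace i with (n + (i - n))%nat by lia. rewrite !lead_shift. apply H. lia. }
  assert (Hgap : forall v v' p p', valid v -> valid v' ->
    3 / 2 <= p <= B -> dval p (lead K M m v) = 1 -> 3 / 2 <= p' <= B -> dval p' (lead K M m v') = 1 ->
    (forall i, (i < h)%nat -> block K M m v i = block K M m v' i) ->
    (block K M m v h < block K M m v' h)%nat ->
    margin * / B ^ n * / B ^ 3 * / (9 * INR K) / rate ^ j <= Rabs (p - p')).
  { intros v v' p p' Hv Hv' Hp H2 Hp' H2' Hag' Hh.
    pose proof (first_difference_gap K p (lead K M m v) (lead K M m v') (n + h) ltac:(lra)
      (lead_bounded v Hv) (lead_bounded v' Hv') (Hlag v v' Hag')) as G.
    rewrite !lead_shift in G. specialize (G Hh).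
    destruct (lead_tails v p (S (n + h)) Hv Hp H2 ltac:(lia)) as [T _].
    pose proof (dval_lipschitz K p p' (lead K M m v') ltac:(lra) ltac:(lra) (lead_bounded v' Hv')) as Lp.
    rewrite H2' in Lp. rewrite H2 in G.
    pose proof (Rle_abs (dval p (lead K M m v') - 1)) as Ha.
    assert (HBh : / B ^ n * / B ^ S h <= / p ^ S (n + h)).
    { rewrite <- Rinv_mult, <- pow_add. replace (n + S h)%nat with (S (n + h)) by lia.
      apply Rinv_le_contravar; [apply pow_lt; lra|]. apply pow_incr; lra. }
    assert (0 < / B ^ n) by (apply Rinv_0_lt_compat, pow_lt; lra).
    assert (0 < / B ^ S h) by (apply Rinv_0_lt_compat, pow_lt; lra).
    assert (Hmain : margin * (/ B ^ n * (/ B ^ 3 / rate ^ j)) <= 9 * INR K * Rabs (p - p')).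
    { apply Rle_trans with (margin * (/ B ^ n * / B ^ S h)).
      - apply Rmult_le_compat_l; [lra|]. apply Rmult_le_compat_l; lra.
      - apply Rle_trans with (margin * / p ^ S (n + h)); [apply Rmult_le_compat_l; lra|].
        apply Rle_trans with ((1 - dval p (tail (S (n + h)) (lead K M m v))) / p ^ S (n + h)); [|lra].
        apply Rmult_le_compat_r; [|lra]. left. apply Rinv_0_lt_compat, pow_lt; lra. }
    apply Rmult_le_reg_l with (9 * INR K); [lra|].
    apply Rle_trans with (2 := Hmain). right. unfold Rdiv.
    field. repeat split; try apply pow_nonzero; try lra.
    apply Rgt_not_eq, exp_pos. }
  destruct (Nat.lt_gt_cases (block K M m w h) (block K M m w' h)) as [[L|L] _]; auto.
  - apply (Hgap w w' q q'); auto.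
  - rewrite Rabs_minus_sym. apply (Hgap w' w q' q); auto. intros; symmetry; auto.
Qed.

Lemma rate_gt1 : 1 < rate.
Proof.
  assert (0 < / INR m) by (apply Rinv_0_lt_compat, lt_0_INR; lia).
  unfold rate. rewrite <- (Rpower_O B) at 1 by (pose proof HB; lra). apply Rpower_lt; [pose proof HB|unfold Rdiv]; lra.
Qed.

Lemma univoque_set_not_null sigma : 0 <= sigma -> Rpower rate sigma <= INR (core_size K M) ->
  ~ hausdorff_null sigma (univoque_set M B).
Proof.
  intros Hs Hr.
  assert (0 < / B ^ n * / B ^ 3) by (apply Rmult_lt_0_compat; apply Rinv_0_lt_compat, pow_lt; pose proof HB; lra).
  apply (not_null_of_separated _ (core_size K M) rate (/ B ^ n * / B ^ 3) sigma
    (fun w => dval B (block K M m w))); auto.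
  - unfold core_size; lia.
  - apply rate_gt1.
  - apply block_in_univoque_set.
  - intros w w' j Hw Hw' Hag Hj. apply block_separated; auto.
Qed.

Lemma univoque_bases_not_null sigma (A : R -> Prop) : 0 <= sigma -> Rpower rate sigma <= INR (core_size K M) ->
  (forall w q, valid w -> 3 / 2 <= q <= B -> dval q (lead K M m w) = 1 -> A q) ->
  ~ hausdorff_null sigma A.
Proof.
  intros Hs Hr HA.
  set (X := fun w => epsilon (inhabits 0) (fun q => 3 / 2 <= q <= B /\ dval q (lead K M m w) = 1)).
  assert (HX : forall w, valid w -> 3 / 2 <= X w <= B /\ dval (X w) (lead K M m w) = 1).
  { intros w Hw. apply (epsilon_spec (inhabits 0) _ (lead_base_exists w Hw)). }
  apply (not_null_of_separated _ (core_size K M) rate (margin * / B ^ n * / B ^ 3 * / (9 * INR K)) sigma X); auto.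
  - unfold core_size; lia.
  - apply rate_gt1.
  - pose proof HB. pose proof margin_pos.
    repeat apply Rmult_lt_0_compat; auto; apply Rinv_0_lt_compat; try apply pow_lt; try lra.
    unfold B in *; lra.
  - intros w Hw. destruct (HX w Hw). apply (HA w); auto.
  - intros w w' j Hw Hw' Hag Hj. destruct (HX w Hw), (HX w' Hw'). apply (lead_separated w w' j); auto.
Qed.
End Construction.

(** * The dimensions *)

Lemma core_dim_trivial K M : (2 * K <= M)%nat -> core_dim K M = 0.
Proof.
  intros H. unfold core_dim, core_size. replace (2 * K - M)%nat with 0%nat by lia.
  simpl. rewrite ln_1. unfold Rdiv. ring.
Qed.

(** The condition is [(1 + 2 / m) sigma <= D], that is [m >= 2 sigma / (D - sigma)]; the two extra
    successors ensure [m >= 2]. *)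
Lemma rate_choice K M sigma : (1 <= K <= M)%nat -> 0 <= sigma < core_dim K M ->
  exists m, (2 <= m)%nat /\ Rpower (Rpower (INR K + 1) (1 + 2 / INR m)) sigma <= INR (core_size K M).
Proof.
  intros HK Hs. destruct (core_dim_spec K M HK) as (_ & _ & HB). set (D := core_dim K M) in *.
  destruct (INR_unbounded (2 * sigma / (D - sigma))) as [k Hk].
  exists (S (S k)). split; [lia|]. rewrite <- HB, Rpower_mult.
  assert (0 < INR K) by (apply lt_0_INR; lia).
  apply Rle_Rpower; [lra|].
  assert (Hm : INR k <= INR (S (S k))) by (apply le_INR; lia).
  assert (Hm0 : 0 < INR (S (S k))) by (apply lt_0_INR; lia).
  apply Rmult_lt_compat_r with (r := D - sigma) in Hk; [|lra].
  unfold Rdiv in Hk at 1. rewrite Rmult_assoc, Rinv_l, Rmult_1_r in Hk by lra.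
  apply Rmult_le_reg_r with (INR (S (S k))); auto.
  replace ((1 + 2 / INR (S (S k))) * sigma * INR (S (S k))) with (sigma * INR (S (S k)) + 2 * sigma) by (field; lra).
  nra.
Qed.

Lemma hausdorff_dim_univoque_set_le K M q : (1 <= K <= M)%nat -> 1 < q <= INR K + 1 ->
  Rbar_le (hausdorff_dim (univoque_set M q)) (core_dim K M).
Proof.
  intros HK Hq. destruct (core_dim_spec K M HK) as (_ & HD & _).
  apply hausdorff_dim_le; [lra|]. intros s Hs. apply small_covers_null; [lra|].
  apply (univoque_set_small_covers K M); auto.
Qed.

Lemma hausdorff_dim_univoque_set K M : (1 <= K <= M)%nat ->
  hausdorff_dim (univoque_set M (INR K + 1)) = core_dim K M.
Proof.
  intros HK. assert (0 < INR K) by (apply lt_0_INR; lia).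
  apply Rbar_le_antisym; [apply hausdorff_dim_univoque_set_le; auto; lra|].
  apply hausdorff_dim_ge. intros s Hs.
  (* With at most one digit in the core the dimension is 0 and no exponent lies below it. *)
  destruct (Nat.le_gt_cases (2 * K) M) as [L|L]; [rewrite core_dim_trivial in Hs; auto; lra|].
  destruct (rate_choice K M s HK Hs) as (m & Hm & Hr).
  apply (univoque_set_not_null K M m); auto; lra.
Qed.

(** Stated for any set between the constructed bases and the univoque bases up to [K + 1], so that
    it serves both claims of the theorem. *)
Lemma hausdorff_dim_bases K M (A : R -> Prop) : (1 <= K <= M)%nat ->
  (forall q, A q -> q <= INR K + 1 /\ univoque_bases M q) ->
  (forall m w q, (2 <= m)%nat -> (M < 2 * K)%nat -> (forall i, (w i < core_size K M)%nat) ->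
     3 / 2 <= q <= INR K + 1 -> dval q (lead K M m w) = 1 -> A q) ->
  hausdorff_dim A = core_dim K M.
Proof.
  intros HK Hup Hlow. destruct (core_dim_spec K M HK) as (_ & HD & _).
  apply Rbar_le_antisym.
  - apply hausdorff_dim_le; [lra|]. intros s Hs. apply small_covers_null; [lra|].
    apply small_covers_subset with (1 := Hup). apply univoque_bases_small_covers; auto.
  - apply hausdorff_dim_ge. intros s Hs.
    destruct (Nat.le_gt_cases (2 * K) M) as [L|L]; [rewrite core_dim_trivial in Hs; auto; lra|].
    destruct (rate_choice K M s HK Hs) as (m & Hm & Hr).
    apply (univoque_bases_not_null K M m); auto; try lra.
    intros w q Hw Hq H1. apply (Hlow m w); auto.
Qed.

(** Every expansion over the smaller alphabet is one over the larger, so uniqueness passes down as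
    soon as 1 has an expansion there. *)
Lemma unique_expansion_smaller_alphabet J M q d : 1 < q -> (J <= M)%nat ->
  bounded J d -> dval q d = 1 -> unique_expansion M q 1 -> unique_expansion J q 1.
Proof.
  intros Hq HJ Hd H1 (e & He & Hun). exists d. split; [apply is_expansion_dval; auto|].
  intros d' [Hd' Hs'] n.
  assert (Hext : forall f, bounded J f -> is_series (fun n => INR (f n) / q ^ S n) 1 -> f n = e n).
  { intros f Hf Hs. apply Hun. split; auto. intros i. specialize (Hf i). lia. }
  rewrite (Hext d'), (Hext d); auto.
  apply (proj2 (is_expansion_dval J q 1 d Hq) (conj Hd H1)).
Qed.

(** Reflecting the tail after a positive digit followed by 0 gives a sequence starting with [J], of
    value at least [J / q >= 1], which uniqueness forbids. *)
Lemma not_univoque_larger_alphabet J q d i : 1 < q -> q <= INR J ->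
  bounded J d -> dval q d = 1 -> (0 < d i)%nat -> d (S i) = 0%nat -> ~ univoque_bases J q.
Proof.
  intros Hq HqJ Hd H1 Hi Hi' [HJ (e & He & Hun)].
  assert (Hde : forall n, d n = e n) by (apply Hun, is_expansion_dval; auto).
  destruct (tails_of_unique J q 1 d HJ) as [_ Hl].
  - apply is_expansion_dval; auto.
  - intros f Hf n. rewrite Hde. auto.
  - specialize (Hl i Hi).
    pose proof (dval_ge_term J q (reflect J (tail (S i) d)) 0 Hq (bounded_reflect _ _)) as G.
    unfold reflect at 1, tail at 1 in G. rewrite Nat.add_0_r, Hi', Nat.sub_0_r, pow_1 in G.
    assert (1 <= INR J / q); [|lra].
    apply Rmult_le_reg_r with q; [lra|]. unfold Rdiv. rewrite Rmult_assoc, Rinv_l; lra.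
Qed.

Theorem theorem4 (M : nat) (HM : (1 <= M)%nat) :
  (* (i) *)
  (forall K : nat, (1 <= K <= M)%nat ->
     exists q0 : R,
       1 < q0 <= INR K + 1 /\
       hausdorff_dim (fun q => forall J : nat, (K <= J <= M)%nat -> univoque_bases J q)
         = hausdorff_dim (univoque_set M q0) /\
       (forall q : R, 1 < q <= INR K + 1 ->
          Rbar_le (hausdorff_dim (univoque_set M q)) (hausdorff_dim (univoque_set M q0))))
  /\
  (* (ii) *)
  (forall L : nat, (1 <= L)%nat ->
     hausdorff_dim (fun q => univoque_bases L q /\
                     forall J : nat, (1 <= J)%nat -> J <> L -> ~ univoque_bases J q)
       = Finite 1).
Proof.
  split.
  - intros K HK. exists (INR K + 1). assert (0 < INR K) by (apply lt_0_INR; lia).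
    rewrite hausdorff_dim_univoque_set by auto.
    split; [lra|split].
    + apply hausdorff_dim_bases; auto.
      * intros q Hq. split; [|apply Hq; lia]. apply (Hq K). lia.
      * intros m w q Hm HMK Hw Hq H1 J HJ.
        assert (INR K <= INR J) by (apply le_INR; lia).
        split; [lra|].
        apply (unique_expansion_smaller_alphabet J M q (lead K M m w)); auto; try lra; try lia.
        -- intros i. pose proof (lead_digits K M m HK HMK Hm w i Hw). lia.
        -- apply (lead_unique K M m HK HMK Hm w); auto.
    + intros q Hq. apply hausdorff_dim_univoque_set_le; auto.
  - intros L HL. assert (HLr : 1 <= INR L) by (apply (le_INR 1); auto).
    replace 1 with (core_dim L L).
    2:{ unfold core_dim, core_size. replace (2 * L - L)%nat with L by lia. rewrite S_INR.
        field. apply Rgt_not_eq. rewrite <- ln_1. apply ln_increasing; lra. }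
    apply hausdorff_dim_bases; [lia| |].
    + intros q [Hq _]. split; auto. apply Hq.
    + intros m w q Hm HLL Hw Hq H1.
      assert (HLLL : (1 <= L <= L)%nat) by lia.
      pose proof (lead_bounded L L m HLLL HLL Hm w Hw) as Hb.
      split; [split; [lra|apply (lead_unique L L m HLLL HLL Hm w); auto]|].
      intros J HJ HJL. destruct (Nat.lt_gt_cases J L) as [[HJ'|HJ'] _]; auto.
      (* For [J < L], the bound [L / q + L / q ^ 2 <= 1] forces [q > L >= J + 1], so [q] is outside
         the range of bases for [J]. *)
      * intros [HqJ _].
        pose proof (lead_two_terms L L m HLLL HLL Hm w q ltac:(lra) Hw) as H2. rewrite H1 in H2.
        assert (0 < INR L / q ^ 2) by (apply Rdiv_lt_0_compat; [lra|apply pow_lt; lra]).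
        assert (INR L / q * q = INR L) by (field; lra).
        assert (INR J + 1 <= INR L) by (rewrite <- S_INR; apply le_INR; lia). nra.
      (* For [J > L], [q <= L + 1 <= J]; position [m + 1] holds the last [L] of the leading run and
         position [m + 2] the digit [L - L = 0] that opens the first block. *)
      * assert (INR L + 1 <= INR J) by (rewrite <- S_INR; apply le_INR; lia).
        apply (not_univoque_larger_alphabet J q (lead L L m w) (m + 1)); try lra; auto.
        -- intros i. specialize (Hb i). lia.
        -- rewrite lead_start; lia.
        -- replace (S (m + 1)) with (m + 2 + 0)%nat by lia. rewrite lead_shift, block_0. lia.
Qed.
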